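(* Let $n \ge 2$ and let $\Omega \subset \mathbb{R}^n$ be an unbounded domain. Let $r_* > 0$ be such that $S_r \cap \Omega \neq \emptyset$ for all $r > r_*$, where $S_r$ is the sphere of radius $r$ centered at the origin. Let $f : \Omega \times [0,\infty) \to \mathbb{R}$ be a function with $f(x,t) > 0$ for all $x \in \Omega$ and all $t > 0$. Suppose there exist real numbers $\sigma > 1$, $\theta > 1$ and non-negative measurable functions $q$ (defined on $(r_*,\infty)$) and $g$ (defined on $(0,\infty)$) with $\inf_K g > 0$ for every compact $K \subset (0,\infty)$, such that $$\inf_{x \in \Omega_{r,\sigma},\ \zeta \in (t/\theta,\, t\theta)} f(x, |x|\zeta) \ge q(r)\, g(t)$$ for all $t > 0$ and $r > r_*$, where $\Omega_{r,\sigma} = \{x \in \Omega : r/\sigma < |x| < r\sigma\}$. Suppose moreover that $$\int_1^\infty (g(t)\,t)^{-1/4}\,dt < \infty \quad\text{and}\quad \int_{r_*}^\infty q(r)\,dr = \infty.$$ Then every non-negative (viscosity) solution $u$ of the problem $$\Delta_\infty u \ge f(x,u) \ \text{in } \Omega, \qquad u|_{\partial\Omega} = 0$$ is identically zero.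
   Context: The $\infty$-Laplacian is $\Delta_\infty u = \sum_{i,j=1}^n \frac{\partial^2 u}{\partial x_i \partial x_j}\frac{\partial u}{\partial x_i}\frac{\partial u}{\partial x_j}$. For $u:\Omega \to \mathbb{R}$ and $x \in \Omega$, the second-order superjet $J^{2,+}_\Omega u(x)$ is the set of pairs $(v,A)$ with $v \in \mathbb{R}^n$ and $A$ a symmetric $n\times n$ matrix such that $u(y) - u(x) \le \langle v, y-x\rangle + \frac12 \langle A(y-x), y-x\rangle + o(|y-x|^2)$ for all $y$ in some neighborhood of $x$. A function $u \ge 0$ on $\overline{\Omega}$ is a non-negative solution of the problem if $u$ is upper semicontinuous on $\overline{\Omega}$ (i.e. $\limsup_{y\to x} u(y) \le u(x)$ for every $x \in \overline\Omega$), $u = 0$ on $\partial\Omega$, and for every $x \in \Omega$ with $J^{2,+}_\Omega u(x) \ne \emptyset$ one has $\langle Av, v\rangle \ge f(x,u(x))$ for all $(v,A) \in J^{2,+}_\Omega u(x)$. If $\Omega = \mathbb{R}^n$ (so $\partial\Omega = \emptyset$), the boundary condition is void. *)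

(* Defs.v *)
From HB Require Import structures.
From mathcomp Require Import all_boot all_order all_algebra.
From mathcomp Require Import all_classical all_reals all_analysis.
Set Implicit Arguments. Unset Strict Implicit. Unset Printing Implicit Defensive.
Import Order.TTheory GRing.Theory Num.Theory.
Import numFieldNormedType.Exports.
Local Open Scope classical_set_scope.
Local Open Scope ring_scope.

Definition dotv {R : realType} {n : nat} (v w : 'rV[R]_n) : R :=
  \sum_(i < n) v ord0 i * w ord0 i.

Definition enorm {R : realType} {n : nat} (v : 'rV[R]_n) : R :=
  Num.sqrt (dotv v v).

(* <A v, v> for a square matrix A (A acting on column vectors). *)
Definition quadf {R : realType} {n : nat} (A : 'M[R]_n) (v : 'rV[R]_n) : R :=
  dotv (v *m A^T) v.

Definition superjet {R : realType} {n : nat} (Omega : set 'rV[R]_n)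
  (u : 'rV[R]_n -> R) (x : 'rV[R]_n) (v : 'rV[R]_n) (A : 'M[R]_n) : Prop :=
  A^T = A /\
  forall eps : R, 0 < eps -> exists delta : R, 0 < delta /\
    forall y, Omega y -> enorm (y - x) < delta ->
      u y - u x <= dotv v (y - x) + 2^-1 * quadf A (y - x)
                   + eps * enorm (y - x) ^+ 2.

(* Upper semicontinuity on closure Omega (u is only defined there). *)
Definition usc_on {R : realType} {n : nat} (D : set 'rV[R]_n)
  (u : 'rV[R]_n -> R) : Prop :=
  forall x, D x -> forall eps : R, 0 < eps -> exists delta : R, 0 < delta /\
    forall y, D y -> enorm (y - x) < delta -> u y <= u x + eps.

Definition bdry {R : realType} {n : nat} (Omega : set 'rV[R]_n) : set 'rV[R]_n :=
  closure Omega `\` interior Omega.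

Definition nonneg_solution {R : realType} {n : nat} (Omega : set 'rV[R]_n)
  (f : 'rV[R]_n -> R -> R) (u : 'rV[R]_n -> R) : Prop :=
  (forall x, closure Omega x -> 0 <= u x) /\
  usc_on (closure Omega) u /\
  (forall x, bdry Omega x -> u x = 0) /\
  (forall x, Omega x -> forall v A, superjet Omega u x v A ->
      f x (u x) <= quadf A v).

(* The real line equipped with the Lebesgue (completed) sigma-algebra. *)
Definition LebR (R : realType) := caratheodory_type (@wlength R idfun)^*%mu.

(* Main.v *)
Require Import Defs.
From HB Require Import structures.
From mathcomp Require Import all_boot all_order all_algebra.
From mathcomp Require Import all_classical all_reals all_analysis.
From mathcomp Require Import measurable_realfun ring lra.
Import Order.TTheory GRing.Theory Num.Theory.
Import numFieldNormedType.Exports.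
Local Open Scope classical_set_scope.
Local Open Scope ring_scope.

(* Assume [u] is positive somewhere and let [N r] be the maximum of [u] over the
   ball of radius [r]. Touching [u] from above by radial parabolas shows that [N]
   is a convex viscosity solution of [N'^2 N'' >= f], that is, roughly,
   [N'^2 N'' >= Q(r) g(N/r)], where [Q(r)] is the supremum of [q] near [r].
   Cut the half-line into windows of constant ratio and replace [r Q(r)] by
   [p = min(1, r Q(r))]; since [q] is locally bounded, [int p dr/r] still diverges.
   As long as [m = N/r] stays in a level [c, th c], the slope satisfies
   [N'^3 >~ g(c) T], with [T] the part of [int p dr/r] spent in the level, and once
   [N' >= 2 th c] the supporting line expels [m] from the level in a time of order
   [c / N']. Hence [T <~ x^4 + x] with [x = c (g(c) c)^(-1/4)]. These [x] are
   summable over geometric levels by the integrability condition on [g], so the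
   total time [int p dr/r] would be finite. *)

(** * Euclidean norm, maxima of upper semicontinuous functions, radial superjets *)

Section Euclidean.
Context {R : realType} {n : nat}.
Implicit Types (v w x y : 'rV[R]_n) (a b : R).

Lemma dotvC v w : dotv v w = dotv w v.
Proof. by apply: eq_bigr => i _; rewrite mulrC. Qed.

Lemma dotvDl v w x : dotv (v + w) x = dotv v x + dotv w x.
Proof. by rewrite -big_split; apply: eq_bigr => i _; rewrite mxE mulrDl. Qed.

Lemma dotvZl a v w : dotv (a *: v) w = a * dotv v w.
Proof. by rewrite mulr_sumr; apply: eq_bigr => i _; rewrite mxE mulrA. Qed.

Lemma dotvDr v w x : dotv x (v + w) = dotv x v + dotv x w.
Proof. by rewrite dotvC dotvDl !(dotvC x). Qed.

Lemma dotvZr a v w : dotv v (a *: w) = a * dotv v w.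
Proof. by rewrite dotvC dotvZl dotvC. Qed.

Lemma dotvv_ge0 v : 0 <= dotv v v.
Proof. by apply: sumr_ge0 => i _; rewrite -expr2 sqr_ge0. Qed.

Lemma enorm_ge0 v : 0 <= enorm v.
Proof. exact: sqrtr_ge0. Qed.

Lemma enorm_sqr v : enorm v ^+ 2 = dotv v v.
Proof. by rewrite sqr_sqrtr // dotvv_ge0. Qed.

Lemma coord_le_enorm v i : `|v ord0 i| <= enorm v.
Proof.
rewrite -sqrtr_sqr ler_sqrt ?dotvv_ge0// /dotv (bigD1 i) //= -expr2 lerDl.
by apply: sumr_ge0 => j _; rewrite -expr2 sqr_ge0.
Qed.

(** Cauchy-Schwarz: the squared norm of [dotv w w *: v - dotv v w *: w] is [dotv w w] times the
    defect of the inequality. *)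
Lemma dotv_sqr_le v w : dotv v w ^+ 2 <= dotv v v * dotv w w.
Proof.
have := dotvv_ge0 w; rewrite le_eqVlt => /orP[/eqP w0|w_gt0].
  have wi i : w ord0 i = 0.
    apply/eqP; rewrite -normr_eq0 eq_le normr_ge0 andbT.
    by rewrite (le_trans (coord_le_enorm w i))// /enorm -w0 sqrtr0.
  rewrite -w0 mulr0 [X in X ^+ 2]big1 ?expr0n// => i _.
  by rewrite wi mulr0.
have := dotvv_ge0 (dotv w w *: v + (- dotv v w) *: w).
rewrite !(dotvDl, dotvDr, dotvZl, dotvZr) (dotvC w v).
set a := dotv w w; set b := dotv v w; set c := dotv v v.
rewrite (_ : _ + _ = a * (c * a - b ^+ 2)); last by ring.
by rewrite pmulr_rge0// subr_ge0.
Qed.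

Lemma dotv_le_enorm v w : `|dotv v w| <= enorm v * enorm w.
Proof.
rewrite -ler_sqr ?nnegrE ?mulr_ge0 ?enorm_ge0//.
by rewrite exprMn !enorm_sqr real_normK ?num_real// dotv_sqr_le.
Qed.

Lemma enormD v w : enorm (v + w) <= enorm v + enorm w.
Proof.
rewrite -ler_sqr ?nnegrE ?addr_ge0 ?enorm_ge0// enorm_sqr.
rewrite sqrrD !enorm_sqr !(dotvDl, dotvDr) (dotvC w v).
have := le_trans (ler_norm _) (dotv_le_enorm v w).
by rewrite mulr2n; lra.
Qed.

Lemma enormN v : enorm (- v) = enorm v.
Proof.
by rewrite /enorm -scaleN1r dotvZl dotvZr mulrA mulrNN !mul1r.
Qed.

Lemma enormB v w : enorm (v - w) = enorm (w - v).
Proof. by rewrite -enormN opprB. Qed.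

Lemma enorm_dist v w : `|enorm v - enorm w| <= enorm (v - w).
Proof.
rewrite ler_norml.
have := enormD (v - w) w; have := enormD (w - v) v.
by rewrite !subrK (enormB w v); move=> *; apply/andP; split; lra.
Qed.

Lemma mx_norm_le_enorm v : `|v| <= enorm v.
Proof.
rewrite [leLHS]/Num.norm /= mx_normrE; apply/bigmax_leP; split.
  exact: enorm_ge0.
by move=> [i j] _ /=; rewrite ord1 coord_le_enorm.
Qed.

Lemma enorm_le_mx_norm v : enorm v <= n%:R * `|v|.
Proof.
rewrite -ler_sqr ?nnegrE ?mulr_ge0 ?enorm_ge0// enorm_sqr exprMn.
have vi i : `|v ord0 i| <= `|v|.
  rewrite [leRHS]/Num.norm /= mx_normrE.
  by apply/bigmax_geP; right => /=; exists (ord0, i).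
apply: (@le_trans _ _ (\sum_(i < n) `|v| ^+ 2)).
  apply: ler_sum => i _; rewrite -expr2 -[leLHS]real_normK ?num_real//.
  by rewrite ler_sqr ?nnegrE.
rewrite sumr_const card_ord -[leLHS]mulr_natl ler_wpM2r ?sqr_ge0//.
by rewrite -natrX ler_nat; case: (n) => // k; rewrite expnS leq_pmulr// expn1.
Qed.

Lemma nbhs_enorm x (e : R) : 0 < e -> \forall y \near x, enorm (y - x) < e.
Proof.
(* [n.+1] instead of [n] keeps the radius positive in dimension zero. *)
move=> e0; have n1 : 0 < n.+1%:R :> R by rewrite ltr0n.
apply/nbhs_normP; exists (e / n.+1%:R); first by rewrite /= divr_gt0.
move=> y /=; rewrite distrC ltr_pdivlMr// mulrC => yx.
apply: le_lt_trans yx; apply: le_trans (enorm_le_mx_norm _) _.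
by rewrite ler_wpM2r// ler_nat.
Qed.

Lemma continuous_enorm : continuous (@enorm R n).
Proof.
move=> x; have FF : Filter (nbhs x) := nbhs_filter x.
apply/(@cvgrPdist_lt _ _ _ (nbhs x) FF) => e e0.
near=> y; rewrite distrC; apply: le_lt_trans (enorm_dist _ _) _.
by near: y; exact: nbhs_enorm.
Unshelve. all: by end_near.
Qed.

Lemma closed_annulus (D : set 'rV[R]_n) a b :
  closed (closure D `&` [set x | a <= enorm x <= b]).
Proof.
apply: closedI; first exact: closed_closure.
rewrite (_ : [set _ | _] = @enorm R n @^-1` `[a, b]%classic); last first.
  by apply/seteqP; split=> x /=; rewrite in_itv.
by apply: closed_comp => [x _|]; [exact: continuous_enorm|exact: itv_closed].
Qed.

Lemma compact_annulus (D : set 'rV[R]_n) a b :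
  compact (closure D `&` [set x | a <= enorm x <= b]).
Proof.
apply: bounded_closed_compact; last exact: closed_annulus.
exists b; split; first exact: num_real.
move=> M bM x [_ /= /andP[_ xb]].
exact: le_trans (mx_norm_le_enorm x) (le_trans xb (ltW bM)).
Qed.

(** The superlevel sets at values of [w] generate a proper filter on [K]; upper semicontinuity at a
    cluster point [p] gives [w y <= w p + e] for all [y] and [e]. *)
Lemma usc_on_attains_max (K : set 'rV[R]_n) (w : 'rV[R]_n -> R) :
  compact K -> K !=set0 -> usc_on K w ->
  exists2 x, K x & forall y, K y -> w y <= w x.
Proof.
move=> cK [z Kz] uw.
pose B y := [set x | K x /\ w y <= w x].
pose F : set_system 'rV[R]_n := filter_from K B.
have FF : ProperFilter F.
  apply: filter_from_proper; last by move=> y Ky; exists y; split.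
  apply: filter_from_filter; first by exists z.
  move=> i j Ki Kj; case: (leP (w i) (w j)) => wij.
    by exists j => // x [Kx jx]; split; split=> //; exact: le_trans wij jx.
  by exists i => // x [Kx ix]; split; split=> //; exact: le_trans (ltW wij) ix.
have FK : F K by exists z => // x [].
have [p [Kp clp]] := cK F FF FK.
exists p => // y Ky; apply/ler_addgt0Pr => e e0.
have [d [d0 Hd]] := uw p Kp e e0.
have FB : F (B y) by exists y.
have [x [[Kx yx] px]] := clp _ _ FB (nbhs_enorm p _ d0).
exact: le_trans yx (Hd _ Kx px).
Qed.

(** Hessians of radial functions have this shape: a multiple of the identity plus a multiple of the
    projection onto the line of [x]. *)
Lemma quadf_rank_one a b x v :
  quadf (a%:M + b *: (x^T *m x)) v = a * dotv v v + b * dotv x v ^+ 2.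
Proof.
have vx : v *m x^T = (dotv x v)%:M.
  apply/rowP => i; rewrite ord1 !mxE eqxx mulr1n dotvC.
  by apply: eq_bigr => j _; rewrite mxE.
rewrite /quadf [(_ + _)^T]raddfD /= tr_scalar_mx linearZ /= trmx_mul trmxK.
rewrite mulmxDr mul_mx_scalar -scalemxAr mulmxA vx mul_scalar_mx.
by rewrite dotvDl !dotvZl -expr2.
Qed.

Lemma superjet_max (D : set 'rV[R]_n) (u : 'rV[R]_n -> R) x (d : R) :
  0 < d -> (forall y, D y -> enorm (y - x) < d -> u y <= u x) ->
  superjet D u x 0 0.
Proof.
move=> d0 Hd; split; first exact: trmx0.
move=> e e0; exists d; split=> // y Dy yx.
rewrite /quadf trmx0 mulmx0.
have d0v w : dotv 0 w = 0 by rewrite -(scale0r 0) dotvZl mul0r.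
rewrite !d0v mulr0 !add0r.
apply: (@le_trans _ _ 0); first by rewrite subr_le0; exact: Hd.
by rewrite mulr_ge0 ?sqr_ge0// ltW.
Qed.

(* With [del = |y| - |x|], the identity [2 |x| del + del^2 = 2 <x,h> + |h|^2] for
   [h = y - x] gives the second order expansion of [|y|] without square roots. *)
Lemma superjet_radial (D : set 'rV[R]_n) (u : 'rV[R]_n -> R) x (d beta lam : R) :
  0 < d -> 0 < enorm x ->
  (forall y, D y -> enorm (y - x) < d ->
     u y - u x <= beta * (enorm y - enorm x) + 2^-1 * lam * (enorm y - enorm x) ^+ 2) ->
  let r := enorm x in
  superjet D u x ((beta / r) *: x)
    ((beta / r)%:M + ((lam - beta / r) / r ^+ 2) *: (x^T *m x)).
Proof.
move=> d0 x0 Hu r.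
split.
  by rewrite [LHS]raddfD /= tr_scalar_mx linearZ /= trmx_mul trmxK.
move=> eps eps0.
(* The expansion error will be at most [2 * K * t ^+ 3] with [t = |y - x|]; the last bound in [dd]
   turns it into [eps * t ^+ 2]. *)
pose K := 2^-1 * `|lam - beta / r| * (r^-1 * (1 + r^-1)).
have K0 : 0 <= K.
  by rewrite !mulr_ge0 ?addr_ge0 ?invr_ge0 ?(ltW x0).
pose dd := Num.min d (Num.min 1 (eps / (2 * K + 1))).
exists dd; split.
  by rewrite !lt_min d0 ltr01 divr_gt0// ltr_wpDl// mulr_ge0.
move=> y Dy; rewrite !lt_min => /and3P[yd y1 yeps].
apply: le_trans (Hu y Dy yd) _.
rewrite quadf_rank_one dotvZl.
set h := y - x in yd y1 yeps *.
set t := enorm h in yd y1 yeps *.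
rewrite -(enorm_sqr h) -/t.
set p := dotv x h.
pose del := enorm y - enorm x.
rewrite -/del.
have t0 : 0 <= t by exact: enorm_ge0.
have delt : `|del| <= t by exact: enorm_dist.
have id1 : 2 * r * del + del ^+ 2 = 2 * p + t ^+ 2.
  have : enorm y ^+ 2 = enorm x ^+ 2 + 2 * p + t ^+ 2.
    rewrite /p /t (_ : y = x + h); last by rewrite /h addrC subrK.
    by move: (h) => k; rewrite !enorm_sqr !(dotvDl, dotvDr) (dotvC k x); ring.
  by rewrite -/r /del -/r => yE; ring: yE.
have r0 : r != 0 by rewrite gt_eqF.
(* The error of the linear approximation of [|y| - |x|]; [id1] shows that it is quadratic in [t]. *)
pose e := p / r - del.
have eE : e = (del ^+ 2 - t ^+ 2) / (2 * r).
  rewrite /e (_ : p = 2^-1 * (2 * r * del + del ^+ 2 - t ^+ 2)); last by rewrite id1; field.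
  by field.
have ebound : `|e| <= t ^+ 2 / r.
  have r2 : 0 <= (2 * r)^-1 by rewrite invr_ge0 mulr_ge0// ltW.
  rewrite eE normrM (ger0_norm r2).
  have : `|del ^+ 2 - t ^+ 2| <= t ^+ 2 * 2.
    have : del ^+ 2 <= t ^+ 2 by rewrite -[leLHS]real_normK ?num_real// ler_sqr ?nnegrE.
    by have := sqr_ge0 del; rewrite ler_norml => *; apply/andP; split; lra.
  move=> H; rewrite invfM mulrA ler_wpM2r ?invr_ge0 ?(ltW x0)//.
  by rewrite ler_pdivrMr.
have key : `|del ^+ 2 - (p / r) ^+ 2| <= 2 * (r^-1 * (1 + r^-1)) * t ^+ 3.
  have -> : p / r = del + e by rewrite /e addrC subrK.
  have -> : del ^+ 2 - (del + e) ^+ 2 = - (e * (2 * del + e)) by ring.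
  rewrite normrN normrM.
  have a2 : `|2 * del + e| <= 2 * t * (1 + r^-1).
    apply: le_trans (ler_normD _ _) _.
    rewrite normrM (ger0_norm (ler0n _ 2)) [leRHS]mulrDr mulr1 lerD ?ler_wpM2l//.
    apply: le_trans ebound _; rewrite ler_wpM2r ?invr_ge0 ?(ltW x0)//.
    rewrite expr2 -subr_ge0 (_ : _ - _ = t * (2 - t)); last by ring.
    by rewrite mulr_ge0// subr_ge0; lra.
  apply: le_trans (ler_pM (normr_ge0 _) (normr_ge0 _) ebound a2) _.
  by rewrite le_eqVlt; apply/orP; left; apply/eqP; ring.
have -> : beta * del + 2^-1 * lam * del ^+ 2 =
   beta / r * p + 2^-1 * (beta / r * t ^+ 2 + (lam - beta / r) / r ^+ 2 * p ^+ 2)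
   + 2^-1 * (lam - beta / r) * (del ^+ 2 - (p / r) ^+ 2).
  have -> : p = 2^-1 * (2 * r * del + del ^+ 2 - t ^+ 2) by rewrite id1; field.
  by field.
rewrite lerD2l; apply: le_trans (ler_norm _) _.
rewrite normrM normrM (ger0_norm (_ : 0 <= 2^-1)) ?invr_ge0//.
apply: (@le_trans _ _ (2 * K * t ^+ 3)).
  apply: le_trans (ler_wpM2l _ key) _; first by rewrite mulr_ge0.
  by rewrite le_eqVlt /K; apply/orP; left; apply/eqP; ring.
have tK : 2 * K * t <= eps.
  move: yeps; rewrite ltr_pdivlMr; last by rewrite ltr_wpDl// mulr_ge0.
  by rewrite mulrDr mulr1 (mulrC t); lra.
rewrite exprS mulrA.
by rewrite ler_wpM2r// sqr_ge0.
Qed.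
End Euclidean.

Lemma usc_on_sub_radial {R : realType} {n : nat} (K D : set 'rV[R]_n)
    (u : 'rV[R]_n -> R) (phi : R -> R) :
  K `<=` D -> continuous phi -> usc_on D u ->
  usc_on K (fun x => u x - phi (enorm x)).
Proof.
move=> KD cphi uu x Kx e e0.
have e2 : 0 < e / 2 by rewrite divr_gt0.
have [d1 [d10 H1]] := uu x (KD _ Kx) _ e2.
have /cvgrPdist_lt/(_ _ e2)/nbhs_normP[d2 /= d20 H2] := cphi (enorm x).
exists (Num.min d1 d2); split; first by rewrite lt_min d10.
move=> y Ky; rewrite lt_min => /andP[y1 y2].
have {}H1 := H1 y (KD _ Ky) y1.
have : `|phi (enorm x) - phi (enorm y)| < e / 2.
  by apply: H2 => /=; rewrite distrC (le_lt_trans (enorm_dist _ _)).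
by rewrite ltr_norml => /andP[? ?]; lra.
Qed.

(** * The maximum of a solution over balls: strict growth and comparison with parabolas *)

Section MaximumOnBalls.
Context {R : realType} {n : nat} (Omega : set 'rV[R]_n).
Context (f : 'rV[R]_n -> R -> R) (u : 'rV[R]_n -> R).
Hypothesis f_gt0 : forall x t, Omega x -> 0 < t -> 0 < f x t.
Hypothesis solu : nonneg_solution Omega f u.

(** [sup] has a default value on empty or unbounded sets; [ballmax_attained] shows that it is a
    genuine maximum once [u] is positive somewhere in the ball. *)
Definition ballmax (r : R) : R :=
  sup [set u x | x in closure Omega `&` [set x | enorm x <= r]].

Lemma closure_pos_mem x : closure Omega x -> 0 < u x -> Omega x.
Proof.
move=> clx ux; apply: contrapT => nOx.
have [_ [_ [u0 _]]] := solu.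
have : bdry Omega x by split=> // /interior_subset.
by move/u0 => e; rewrite e ltxx in ux.
Qed.

(** A positive maximum lies neither on the boundary, where [u] vanishes, nor strictly inside the
    ball, where the jet [(0, 0)] would give [f x (u x) <= 0]. *)
Lemma ballmax_attained r z : closure Omega z -> enorm z <= r -> 0 < u z ->
  (exists x, [/\ Omega x, enorm x = r & u x = ballmax r]) /\
  (forall y, closure Omega y -> enorm y <= r -> u y <= ballmax r).
Proof.
move=> clz zr uz; have [_ [uscu [_ jetu]]] := solu.
pose K := closure Omega `&` [set x | 0 <= enorm x <= r].
have KE : K = closure Omega `&` [set x | enorm x <= r].
  by apply/seteqP; split=> x [clx /= xr]; split=> //=;
    [case/andP: xr|rewrite enorm_ge0].
have Kz : K z by split=> //=; rewrite enorm_ge0.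
have uscK : usc_on K u.
  move=> x [clx _] e e0; have [d [d0 H]] := uscu x clx e e0.
  by exists d; split=> // y [cly _]; exact: H.
have [x Kx xmax] := usc_on_attains_max K u (compact_annulus _ _ _) (ex_intro _ z Kz) uscK.
have uxE : u x = ballmax r.
  rewrite /ballmax -KE; apply/le_anti/andP; split.
    apply: ub_le_sup; last by exists x.
    by exists (u x) => _ [y Ky <-]; exact: xmax.
  by apply: ge_sup; [exists (u z), z|move=> _ [y Ky <-]; exact: xmax].
have [clx /= /andP[_ xr]] := Kx.
have ux : 0 < u x by exact: lt_le_trans uz (xmax _ Kz).
have Ox := closure_pos_mem _ clx ux.
split; last by move=> y cly yr; rewrite -uxE; apply: xmax; rewrite KE.
exists x; split=> //; apply/eqP; rewrite eq_le xr /= leNgt; apply/negP => xr'.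
have jet : superjet Omega u x 0 0.
  apply: (superjet_max _ _ _ (r - enorm x)); first by rewrite subr_gt0.
  move=> y Oy yx; apply: xmax; rewrite KE; split; first exact: subset_closure.
  have := enorm_dist y x; rewrite /= ler_norml => /andP[_ ?]; lra.
have := jetu x Ox _ _ jet; rewrite leNgt => /negP; apply.
rewrite /quadf trmx0 mulmx0 (_ : dotv 0 0 = 0) ?f_gt0//.
by rewrite /dotv big1// => i _; rewrite mxE mul0r.
Qed.

Context (ra : R) (z : 'rV[R]_n).
Hypotheses (ra_gt0 : 0 < ra) (clz : closure Omega z) (zra : enorm z <= ra)
  (uz : 0 < u z).

Lemma ballmax_gt0 r : ra <= r -> 0 < ballmax r.
Proof.
move=> r_ge; have zr := le_trans zra r_ge.
have [_ H] := ballmax_attained r z clz zr uz.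
exact: lt_le_trans uz (H z clz zr).
Qed.

(** If the two values agreed, a maximum point on the sphere of radius [r] would be a local maximum
    of [u], again with jet [(0, 0)]. *)
Lemma ballmax_lt r s : ra <= r -> r < s -> ballmax r < ballmax s.
Proof.
move=> r_ge rs; have zr := le_trans zra r_ge.
have zs := le_trans zr (ltW rs).
have [[x [Ox xr ux]] _] := ballmax_attained r z clz zr uz.
have [_ Hs] := ballmax_attained s z clz zs uz.
have clx := subset_closure Ox.
have uxs : u x <= ballmax s by apply: Hs; rewrite ?xr ?(ltW rs).
rewrite -ux lt_neqAle uxs andbT; apply/eqP => uxE.
have [_ [_ [_ jetu]]] := solu.
have jet : superjet Omega u x 0 0.
  apply: (superjet_max _ _ _ (s - r)); first by rewrite subr_gt0.
  move=> y Oy yx; rewrite uxE; apply: Hs; first exact: subset_closure.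
  have := enorm_dist y x; rewrite /= ler_norml xr => /andP[_ ?]; lra.
have := jetu x Ox _ _ jet; rewrite leNgt => /negP; apply.
rewrite /quadf trmx0 mulmx0 (_ : dotv 0 0 = 0); last first.
  by rewrite /dotv big1// => i _; rewrite mxE mul0r.
by rewrite f_gt0// ux ballmax_gt0.
Qed.

(* Comparison of [ballmax] with the parabola of second derivative [lam] through
   its end points: where the two touch, [(phi' x/|x|, D^2 phi(|x|))] is in the
   superjet of [u], so that [f x (u x) <= phi'^2 phi''] there. *)
Lemma ballmax_barrier a b lam (s := (ballmax b - ballmax a) / (b - a)) :
  ra <= a -> a < b -> 0 <= lam ->
  (forall x, Omega x -> a < enorm x < b -> u x = ballmax (enorm x) ->
     (s + lam * (b - a) / 2) ^+ 2 * lam < f x (u x)) ->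
  forall y, a <= y <= b ->
    ballmax y <= ballmax a + s * (y - a) - lam / 2 * ((y - a) * (b - y)).
Proof.
move=> raa ab lam0 Hf y /andP[ay yb].
have ba0 : b - a != 0 by rewrite subr_eq0 gt_eqF.
have sE : s * (b - a) = ballmax b - ballmax a by rewrite /s divfK.
pose phi r := ballmax a + s * (r - a) - lam / 2 * ((r - a) * (b - r)).
rewrite leNgt; apply/negP => yphi.
have [_ [uscu [_ jetu]]] := solu.
have s_ge0 : 0 <= s.
  by rewrite divr_ge0 ?subr_ge0 ?(ltW ab)// ltW// ballmax_lt.
have cphi : continuous phi.
  pose p : {poly R} := (ballmax a)%:P + s *: ('X - a%:P)
     - (lam / 2) *: (('X - a%:P) * (b%:P - 'X)).
  rewrite (_ : phi = horner p); first exact: continuous_horner.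
  by apply/funext => r; rewrite /phi /p !(hornerD, hornerN, hornerZ, hornerM, hornerC, hornerX).
pose K := closure Omega `&` [set x | a <= enorm x <= b].
pose w x := u x - phi (enorm x).
have att r : ra <= r -> exists x, [/\ Omega x, enorm x = r & u x = ballmax r].
  by move=> r_ge; have [] := ballmax_attained r z clz (le_trans zra r_ge) uz.
have ubm v : closure Omega v -> ra <= enorm v -> u v <= ballmax (enorm v).
  move=> clv rv; have [_ H] := ballmax_attained _ z clz (le_trans zra rv) uz.
  exact: H.
have [xy [Oxy xyE uxy]] := att y (le_trans raa ay).
have Kxy : K xy by split; [exact: subset_closure|rewrite /= xyE ay yb].
have uscw : usc_on K w by apply: usc_on_sub_radial cphi uscu => v [].
have [x Kx xmax] := usc_on_attains_max K w (compact_annulus _ _ _) (ex_intro _ xy Kxy) uscw.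
have w_gt0 : 0 < w x.
  by apply: lt_le_trans (xmax _ Kxy); rewrite /w xyE uxy subr_gt0.
have [clx /= /andP[ax xb]] := Kx.
have uxle := ubm x clx (le_trans raa ax).
have uxE : u x = ballmax (enorm x).
  apply/le_anti; rewrite uxle /=.
  have [x1 [Ox1 x1E <-]] := att (enorm x) (le_trans raa ax).
  have : w x1 <= w x.
    by apply: xmax; split; [exact: subset_closure|rewrite /= x1E ax xb].
  by rewrite /w x1E lerD2r.
have ux : 0 < u x by rewrite uxE ballmax_gt0// (le_trans raa).
have Ox := closure_pos_mem _ clx ux.
(* Since [phi] agrees with [ballmax] at both ends and [w x > 0], the contact point lies strictly
   inside the annulus. *)
have phia : phi a = ballmax a by rewrite /phi; ring.
have phib : phi b = ballmax b by rewrite /phi sE; ring.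
have ax' : a < enorm x.
  rewrite lt_neqAle ax andbT; apply/eqP => axE.
  by move: w_gt0; rewrite /w uxE -axE phia subrr ltxx.
have xb' : enorm x < b.
  rewrite lt_neqAle xb andbT; apply/eqP => axE.
  by move: w_gt0; rewrite /w uxE axE phib subrr ltxx.
pose r := enorm x.
have r0 : 0 < r by rewrite (lt_le_trans ra_gt0)// (le_trans raa).
(* [beta] is [phi' r]; as [phi] is quadratic, its second order expansion at [r] is exact. *)
pose beta := s + lam / 2 * (2 * r - a - b).
have jet := superjet_radial Omega u x (Num.min (r - a) (b - r)) beta lam.
have {}jet : superjet Omega u x ((beta / r) *: x)
    ((beta / r)%:M + ((lam - beta / r) / r ^+ 2) *: (x^T *m x)).
  apply: jet => //; first by rewrite lt_min !subr_gt0 ax'.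
  move=> v Ov; rewrite lt_min => /andP[va vb].
  have := enorm_dist v x; rewrite ler_norml -/r => /andP[v1 v2].
  have : w v <= w x.
    apply: xmax; split; first exact: subset_closure.
    by apply/andP; split; lra.
  rewrite /w -/r => wvx.
  have -> : beta * (enorm v - r) + 2^-1 * lam * (enorm v - r) ^+ 2
     = phi (enorm v) - phi r by rewrite /phi /beta; field.
  lra.
have := jetu x Ox _ _ jet; rewrite leNgt => /negP; apply.
rewrite quadf_rank_one dotvZl !dotvZr -enorm_sqr -/r.
(* Along the gradient only the radial second derivative survives, which leaves [phi'^2 phi'']. *)
have -> : beta / r * (beta / r * (beta / r * r ^+ 2)) +
   (lam - beta / r) / r ^+ 2 * (beta / r * r ^+ 2) ^+ 2 = beta ^+ 2 * lam.
  by field; rewrite gt_eqF.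
apply: le_lt_trans (Hf x Ox _ uxE); last by rewrite ax' xb'.
(* On [[a, b]] the slope of the parabola is at most [s + lam * (b - a) / 2] in absolute value. *)
rewrite ler_wpM2r// -ler_sqrt ?sqr_ge0// !sqrtr_sqr.
have top0 : 0 <= s + lam * (b - a) / 2.
  by rewrite addr_ge0// divr_ge0// mulr_ge0// subr_ge0 ltW.
rewrite (ger0_norm top0).
have h1 : lam * a <= lam * r by rewrite ler_wpM2l.
have h2 : lam * r <= lam * b by rewrite ler_wpM2l.
by rewrite ler_norml /beta; apply/andP; split; lra.
Qed.

End MaximumOnBalls.

(** * Unbounded powers and truncation of reals to intervals *)

Lemma expr_unbounded {R : realType} (x M : R) : 1 < x -> exists k, M < x ^+ k.
Proof.
move=> x1.
have bernoulli k : 1 + k%:R * (x - 1) <= x ^+ k.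
  elim: k => [|k IH]; first by rewrite mul0r addr0 expr0.
  rewrite exprS -natr1.
  have : x * (1 + k%:R * (x - 1)) <= x * x ^+ k by rewrite ler_wpM2l//; lra.
  have : 0 <= k%:R * (x - 1) * (x - 1).
    by rewrite !mulr_ge0// subr_ge0 ltW.
  lra.
have x10 : 0 < x - 1 by rewrite subr_gt0.
pose k := Num.Def.archi_bound `|M / (x - 1)|.
have Hk : M / (x - 1) < k%:R.
  exact: le_lt_trans (ler_norm _) (archi_boundP (normr_ge0 _)).
exists k; apply: lt_le_trans (bernoulli k).
by move: Hk; rewrite ltr_pdivrMr//; lra.
Qed.

(** Both sides are the length of the intersection of [[a, b]] and [[p, q]]. *)
Lemma clamp_swap {R : realType} (a b p q : R) : a <= b -> p <= q ->
  Num.min (Num.max b p) q - Num.min (Num.max a p) q =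
  Num.min (Num.max q a) b - Num.min (Num.max p a) b.
Proof.
move=> ab pq.
case: (leP p a) => pa; case: (leP p b) => pb; try lra;
case: (leP q a) => qa; case: (leP q b) => qb; try lra;
rewrite ?(min_l pq) ?(min_l ab) ?(min_r ab); try lra.
Qed.

Lemma clamp_le {R : realType} (a b p q : R) : p <= q ->
  Num.min (Num.max p a) b <= Num.min (Num.max q a) b.
Proof.
move=> pq; rewrite le_min ge_min ge_max !le_max !ge_min pq !lexx.
by rewrite !orbT.
Qed.

Lemma clamp_lt {R : realType} (a b p q : R) : a <= b ->
  Num.min (Num.max p a) b < Num.min (Num.max q a) b ->
  p <= Num.min (Num.max p a) b /\ Num.min (Num.max q a) b <= q.
Proof.
move=> ab; case: (leP p a) => pa; case: (leP q a) => qa;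
  rewrite ?(min_l ab); try lra;
  case: (leP q b) => qb; try lra; case: (leP p b) => pb; lra.
Qed.

(** * Growth of a convex function under a lower bound on [N'^2 N''] *)

Section ConvexGrowth.
(* [N r] is the maximum of [u] over the ball of radius [r]; [P r F] abstracts
   "[F < f x (u x)] at every maximum point [x] of norm [r]". *)
Context {R : realType} (N : R -> R) (P : R -> R -> Prop) (ra : R).
Hypothesis N_lt : forall r s, ra <= r -> r < s -> N r < N s.
Hypothesis barrier : forall a b lam, ra <= a -> a < b -> 0 <= lam ->
  (forall r, a < r < b ->
     P r (((N b - N a) / (b - a) + lam * (b - a) / 2) ^+ 2 * lam)) ->
  forall y, a <= y <= b ->
    N y <= N a + (N b - N a) / (b - a) * (y - a) - lam / 2 * ((y - a) * (b - y)).
Hypothesis P0 : forall r, ra <= r -> P r 0.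

Let slope a b := (N b - N a) / (b - a).

Lemma slope_mul a b : a < b -> slope a b * (b - a) = N b - N a.
Proof. by move=> ab; rewrite /slope divfK// subr_eq0 gt_eqF. Qed.

(** Convexity is the barrier with [lam = 0], whose side condition is then [P0]. *)
Lemma le_chord a b y : ra <= a -> a <= y <= b -> a < b ->
  N y <= N a + slope a b * (y - a).
Proof.
move=> raa yab ab; have := barrier a b 0 raa ab (lexx 0) _ y yab.
rewrite !mul0r subr0; apply => r /andP[ar _]; rewrite mulr0.
by apply: P0; rewrite (le_trans raa)// ltW.
Qed.

Lemma slope_left a b c : ra <= a -> a < b -> b < c -> slope a b <= slope b c.
Proof.
move=> raa ab bc; have ac := lt_trans ab bc.
have := le_chord a c b raa _ ac; rewrite (ltW ab) (ltW bc) => /(_ isT).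
have Ec := slope_mul a c ac => h.
apply: (@le_trans _ _ (slope a c)).
  by rewrite ler_pdivrMr ?subr_gt0//; lra.
by rewrite ler_pdivlMr ?subr_gt0//; lra.
Qed.

(** The right derivative of the convex [N]: for [r >= ra] the chord slopes decrease as [y] tends to
    [r], so their limit is this infimum. *)
Definition rder r : R := inf [set slope r y | y in [set y | r < y]].

Lemma slope_ge0 a b : ra <= a -> a < b -> 0 <= slope a b.
Proof.
by move=> raa ab; rewrite divr_ge0// subr_ge0 ltW// N_lt.
Qed.

Lemma rder_le_slope r y : ra <= r -> r < y -> rder r <= slope r y.
Proof.
move=> rar ry; apply: ge_inf; last by exists y.
by exists 0 => _ [t /= rt <-]; exact: slope_ge0.
Qed.

Lemma slope_le_rder x r : ra <= x -> x < r -> slope x r <= rder r.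
Proof.
move=> rax xr; apply: lb_le_inf.
  by exists (slope r (r + 1)), (r + 1) => //=; rewrite ltrDl.
by move=> _ [y /= ry <-]; exact: slope_left.
Qed.

Lemma rder_le x y : ra <= x -> x <= y -> rder x <= rder y.
Proof.
move=> rax; rewrite le_eqVlt => /predU1P[->//|xy].
exact: le_trans (rder_le_slope _ _ rax xy) (slope_le_rder _ _ rax xy).
Qed.

Lemma rder_gt0 r : ra < r -> 0 < rder r.
Proof.
move=> rar; apply: lt_le_trans (slope_le_rder _ _ (lexx _) rar).
by rewrite divr_gt0// subr_gt0// N_lt.
Qed.

Lemma supporting_line r y : ra <= r -> r <= y -> N r + rder r * (y - r) <= N y.
Proof.
move=> rar; rewrite le_eqVlt => /predU1P[<-|ry].
  by rewrite subrr mulr0 addr0.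
have := rder_le_slope _ _ rar ry; rewrite ler_pdivlMr ?subr_gt0//; lra.
Qed.

Lemma le_backward_line x r : ra <= x -> x <= r -> N r <= N x + rder r * (r - x).
Proof.
move=> rax; rewrite le_eqVlt => /predU1P[<-|xr].
  by rewrite subrr mulr0 addr0.
have := slope_le_rder _ _ rax xr; rewrite ler_pdivrMr ?subr_gt0//; lra.
Qed.

(* A quantitative form of [(N'^3)' >= 3 F], the constant being irrelevant. The
   curvature [lam] is the largest one for which the parabola stays a barrier. *)
Lemma rder_cube_gain a b F : ra < a -> a < b -> 0 <= F ->
  (forall r F', a < r < b -> F' < F -> P r F') ->
  F * (b - a) / 16 <= rder b ^+ 3 - rder a ^+ 3.
Proof.
move=> raa ab; rewrite le_eqVlt => /predU1P[<- _|F0 HP].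
  have Da := rder_gt0 a raa; have Db := rder_gt0 b (lt_trans raa ab).
  rewrite !mul0r subr_ge0 ler_pXn2r ?nnegrE ?(ltW Da) ?(ltW Db)//.
  by apply: rder_le; apply: ltW.
set d := rder b; set x := rder a.
have d0 : 0 < d by rewrite rder_gt0// (lt_trans raa).
have x0 : 0 < x by rewrite rder_gt0.
pose h := b - a; have h0 : 0 < h by rewrite subr_gt0.
(* The first bound makes [(2 d)^2 lam < F], the second keeps the slope of the parabola at most
   [2 d]. *)
pose lam := Num.min (F / (8 * d ^+ 2)) (2 * d / h).
have d20 : 0 < d ^+ 2 by rewrite exprn_gt0.
have lam0 : 0 < lam by rewrite lt_min !divr_gt0// mulr_gt0.
have lam1 : 8 * (d ^+ 2 * lam) <= F.
  have : lam <= F / (8 * d ^+ 2) by rewrite ge_min lexx.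
  by rewrite ler_pdivlMr ?mulr_gt0// => H; lra.
have lam2 : lam * h <= 2 * d.
  have : lam <= 2 * d / h by rewrite ge_min lexx orbT.
  by rewrite ler_pdivlMr.
have rale := ltW raa.
have sd : slope a b <= d by exact: slope_le_rder.
have s0 := slope_ge0 a b rale ab.
(* At the midpoint the parabola is [lam h^2 / 8] below the chord, so the chords of [N] over the two
   halves have slopes differing by at least [lam h / 2]. *)
have gain : lam * h / 2 <= d - x.
  pose y := (a + b) / 2.
  have ay : a < y by rewrite /y; lra.
  have yb : y < b by rewrite /y; lra.
  have := barrier a b lam rale ab (ltW lam0) _ y.
  rewrite (ltW ay) (ltW yb) -/(slope a b) => H.
  have {}H : N y <= N a + slope a b * (y - a) - lam / 2 * ((y - a) * (b - y)).
    apply: H => // r rab; apply: HP => //.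
    apply: (@le_lt_trans _ _ (4 * (d ^+ 2 * lam))); last by lra.
    rewrite mulrA ler_wpM2r ?(ltW lam0)//.
    rewrite -/h (_ : 4 * d ^+ 2 = (2 * d) ^+ 2); last by ring.
    have lh0 : 0 <= lam * h by rewrite mulr_ge0// ltW.
    rewrite ler_sqr ?nnegrE; lra.
  have E := slope_mul a b ab.
  have hE : h = b - a by [].
  have xs : x <= slope a b - lam * h / 4.
    apply: le_trans (rder_le_slope a y rale ay) _.
    rewrite ler_pdivrMr ?subr_gt0//.
    apply: (@le_trans _ _ (slope a b * (y - a) - lam / 2 * ((y - a) * (b - y)))); first lra.
    by rewrite le_eqVlt /y hE; apply/orP; left; apply/eqP; field.
  have ds : slope a b + lam * h / 4 <= d.
    apply: le_trans (slope_le_rder y b (le_trans rale (ltW ay)) yb).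
    rewrite ler_pdivlMr ?subr_gt0//.
    apply: (@le_trans _ _ (slope a b * (b - a) - (slope a b * (y - a) - lam / 2 * ((y - a) * (b - y))))); last lra.
    by rewrite le_eqVlt /y hE; apply/orP; left; apply/eqP; field.
  lra.
have cube : d ^+ 2 * (d - x) <= d ^+ 3 - x ^+ 3.
  rewrite -subr_ge0 (_ : _ - _ = x * (d - x) * (d + x)); last by ring.
  have lh0 : 0 < lam * h by rewrite mulr_gt0.
  have dx : 0 <= d - x by lra.
  by rewrite mulr_ge0 ?addr_ge0 ?(ltW x0) ?(ltW d0)// mulr_ge0// ltW.
apply: le_trans cube.
case: (leP (F / (8 * d ^+ 2)) (2 * d / h)) => Hmin.
  have lamE : lam = F / (8 * d ^+ 2) by rewrite /lam min_l.
  apply: le_trans (ler_wpM2l (ltW d20) gain).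
  rewrite lamE le_eqVlt -/h; apply/orP; left; apply/eqP; field.
  by rewrite gt_eqF.
have lamE : lam = 2 * d / h by rewrite /lam min_r// ltW.
(* Here [gain] would read [d <= d - x], against [x > 0]. *)
exfalso; move: gain; rewrite lamE divfK ?gt_eqF//; lra.
Qed.

(** * Windows of constant ratio and the weighted time spent in them *)

Context (rk w : nat -> R) (kap : R).
Hypotheses (ra_gt0 : 0 < ra) (rk0 : ra < rk 0) (kap1 : 1 < kap)
  (rkS : forall k, rk k.+1 = kap * rk k).
Hypotheses (w_ge0 : forall k, 0 <= w k) (w_le : forall k, w k * rk k <= 1).

Lemma rk_gt0 k : 0 < rk k.
Proof.
elim: k => [|k IH]; first exact: lt_trans ra_gt0 rk0.
by rewrite rkS mulr_gt0// (lt_trans _ kap1).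
Qed.

Lemma rk_lt k : rk k < rk k.+1.
Proof. by rewrite rkS ltr_pMl// rk_gt0. Qed.

Let clamp k r := Num.min (Num.max r (rk k)) (rk k.+1).

(* The primitive of the step function equal to [w k] on [rk k, rk k.+1] for
   [k < n] and to 0 elsewhere, up to an additive constant. *)
Definition wprim n r : R := \sum_(k < n) w k * clamp k r.

(** Cut [[a, b]] at the points [rk k], truncated to [[a, b]], and add up the window estimates;
    monotonicity of [Phi] covers what lies beyond [rk n]. *)
Lemma wprim_window_le (Phi : R -> R) c n a b : rk 0 <= a -> a <= b ->
  (forall x y, a <= x -> x <= y -> y <= b -> Phi x <= Phi y) ->
  (forall k x y, a <= x -> x < y -> y <= b -> rk k <= x -> y <= rk k.+1 ->
    c * (w k * (y - x)) <= Phi y - Phi x) ->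
  c * (wprim n b - wprim n a) <= Phi b - Phi a.
Proof.
move=> r0a ab mono win.
pose e k := Num.min (Num.max (rk k) a) b.
have e_bd k : a <= e k <= b.
  by rewrite /e le_min le_max lexx orbT ab ge_min lexx orbT.
apply: (@le_trans _ _ (Phi (e n) - Phi a)); last first.
  by rewrite lerD2r; have /andP[? ?] := e_bd n; exact: mono.
elim: n => [|n IH].
  rewrite /wprim !big_ord0 subrr mulr0 (_ : e 0%N = a) ?subrr//.
  by rewrite /e max_r// min_l.
rewrite /wprim !big_ord_recr /= -!/(wprim n _).
have rn := rk_lt n.
have E : clamp n b - clamp n a = e n.+1 - e n.
  exact: clamp_swap ab (ltW rn).
have step : c * (w n * (e n.+1 - e n)) <= Phi (e n.+1) - Phi (e n).
  have /andP[a1 _] := e_bd n; have /andP[_ a4] := e_bd n.+1.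
  have : e n <= e n.+1 by exact: clamp_le (ltW rn).
  rewrite le_eqVlt => /predU1P[->|ee]; first by rewrite !subrr !mulr0.
  by have [? ?] := clamp_lt _ _ _ _ ab ee; exact: win.
rewrite -E in step.
have -> : c * (wprim n b + w n * clamp n b - (wprim n a + w n * clamp n a)) =
  c * (wprim n b - wprim n a) + c * (w n * (clamp n b - clamp n a)) by ring.
lra.
Qed.

(** A window meeting [[a, b]] satisfies [a <= rk k.+1 = kap * rk k], so its weight is at most
    [1 / rk k <= kap / a]. *)
Lemma wprim_lipschitz n a b : rk 0 <= a -> a <= b ->
  wprim n b - wprim n a <= kap / a * (b - a).
Proof.
move=> r0a ab; have a0 : 0 < a by exact: lt_le_trans (rk_gt0 0) r0a.
have ka : 0 <= kap / a by rewrite divr_ge0// ltW// (lt_trans _ kap1).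
have := wprim_window_le (fun r => kap / a * r) 1 n a b r0a ab.
rewrite mul1r -mulrBr; apply.
  by move=> x y _ xy _; rewrite ler_wpM2l.
move=> k x y ax xy yb kx yk; rewrite mul1r -mulrBr ler_wpM2r ?subr_ge0 ?(ltW xy)//.
rewrite ler_pdivlMr//; apply: (@le_trans _ _ (w k * rk k.+1)).
  by rewrite ler_wpM2l//; lra.
by rewrite rkS mulrCA ler_piMr// ltW// (lt_trans _ kap1).
Qed.

Lemma wprim_continuous n : continuous (wprim n).
Proof.
elim: n => [|n IH].
  rewrite (_ : wprim 0 = fun=> 0); first exact: cst_continuous.
  by apply/funext => r; rewrite /wprim big_ord0.
have -> : wprim n.+1 = fun r => wprim n r + w n * clamp n r.
  by apply/funext => r; rewrite /wprim big_ord_recr.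
move=> x; apply: cvgD; first exact: IH.
apply: cvgMr; apply: (@continuous_min _ _ (fun r => Num.max r (rk n)) (fun=> rk n.+1)).
  by apply: (@continuous_max _ _ (fun r => r) (fun=> rk n)); [exact: cvg_id|exact: cvg_cst].
exact: cvg_cst.
Qed.

Lemma wprim_IVT n a b v : a <= b -> wprim n a <= v <= wprim n b ->
  exists2 r, a <= r <= b & wprim n r = v.
Proof.
move=> ab avb; have /andP[av vb] := avb.
have [||r rab rE] := @IVT R (wprim n) a b v ab.
- exact: continuous_subspaceT (wprim_continuous n).
- by rewrite min_l ?max_r// (le_trans av).
- by exists r => //; rewrite in_itv in rab.
Qed.

(** Window [k] has length [(kap - 1) * rk k], so a divergent sum on the right means infinite total
    time. *)
Lemma wprim_total n : wprim n (rk n) - wprim n (rk 0) =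
  (kap - 1) * \sum_(k < n) w k * rk k.
Proof.
have mono i j : (i <= j)%N -> rk i <= rk j.
  elim: j => [|j IH]; first by rewrite leqn0 => /eqP->.
  rewrite leq_eqVlt => /predU1P[->//|]; rewrite ltnS => /IH/le_trans; apply.
  exact: ltW (rk_lt j).
rewrite mulr_sumr /wprim -sumrB; apply: eq_bigr => k _.
have kn : rk k.+1 <= rk n by exact: mono.
have k0 : rk 0 <= rk k by exact: mono.
have kk := rk_lt k.
rewrite /clamp (max_l (le_trans (ltW kk) kn)) (min_r kn) (max_r k0) (min_l (ltW kk)).
by rewrite rkS; ring.
Qed.

(* [Gd m G] abstracts "[G] bounds [g] from below at some [t] with
   [t / theta < m < t * theta]". *)
Context (Gd : R -> R -> Prop).
Hypothesis P_Gd : forall k r G F, rk k <= r <= rk k.+1 -> Gd (N r / r) G ->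
  0 <= G -> F < w k * G -> P r F.

Lemma rder_cube_gain_windows n a b G : rk 0 <= a -> a <= b -> 0 <= G ->
  (forall r, a <= r <= b -> Gd (N r / r) G) ->
  G / 16 * (wprim n b - wprim n a) <= rder b ^+ 3 - rder a ^+ 3.
Proof.
move=> r0a ab G0 HG.
have raa : ra < a by exact: lt_le_trans rk0 r0a.
apply: (wprim_window_le (fun r => rder r ^+ 3) _ _ _ _ r0a ab) => [x y ax xy yb|k x y ax xy yb kx yk].
  have rax := lt_le_trans raa ax.
  have Dx := rder_gt0 x rax; have Dy := rder_gt0 y (lt_le_trans rax xy).
  by rewrite ler_pXn2r ?nnegrE ?(ltW Dx) ?(ltW Dy)//; exact: rder_le (ltW rax) xy.
have := rder_cube_gain x y (w k * G) (lt_le_trans raa ax) xy.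
rewrite mulr_ge0// => /(_ isT) H.
rewrite (_ : _ * _ = w k * G * (y - x) / 16); last by field.
apply: H => r F /andP[xr ry] FG; apply: (P_Gd k r G F) => //.
  by rewrite (le_trans kx (ltW xr)) (le_trans (ltW ry) yk).
by apply: HG; rewrite (le_trans ax (ltW xr)) (le_trans (ltW ry) yb).
Qed.

(* Half of the time spent in a level raises the slope; with that slope, the
   supporting line forces [N r / r] out of the level during the other half. *)
Lemma level_time n a b C G y : rk 0 <= a -> a <= b -> 0 < C -> 0 < G -> 0 < y ->
  (forall r, a <= r <= b -> Gd (N r / r) G) -> 0 <= N a ->
  N b <= C * b -> C ^+ 3 <= G * y ^+ 4 ->
  wprim n b - wprim n a <= 256 * y ^+ 4 + 8 * kap * y.
Proof.
move=> r0a ab C0 G0 y0 HG Na NbC Cy.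
set tau := wprim n b - wprim n a.
have kap0 : 0 < kap by exact: lt_trans kap1.
have y40 : 0 < y ^+ 4 by rewrite exprn_gt0.
have ky0 : 0 < kap * y by rewrite mulr_gt0.
case: (leP tau 0) => [tau0|tau0]; first by apply: (le_trans tau0); lra.
(* [r] is the point at which half of the time [tau] has elapsed. *)
have [|r /andP[ar rb] rE] := wprim_IVT n a b (wprim n a + tau / 2) ab.
  by rewrite /tau; apply/andP; split; rewrite /tau in tau0; lra.
have raa : ra < a by exact: lt_le_trans rk0 r0a.
have rar : ra < r by exact: lt_le_trans raa ar.
have r0 : 0 < r by exact: lt_trans ra_gt0 rar.
have D0 := rder_gt0 r rar; set D := rder r in D0 *.
have Dcube : G * tau / 32 <= D ^+ 3.
  have := rder_cube_gain_windows n a r G r0a ar (ltW G0) _.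
  rewrite rE => H; have {H} : G / 16 * (wprim n a + tau / 2 - wprim n a) <= D ^+ 3 - rder a ^+ 3.
    by apply: H => s /andP[as_ sr]; apply: HG; rewrite as_ (le_trans sr).
  have : 0 < rder a ^+ 3 by rewrite exprn_gt0// rder_gt0.
  rewrite (_ : _ * _ = G * tau / 32); last by field.
  lra.
(* If the slope is still below [2 C], the cube estimate alone gives [tau <= 256 y ^+ 4]. *)
case: (ltP D (2 * C)) => DC.
  have : D ^+ 3 <= (2 * C) ^+ 3 by rewrite ler_pXn2r ?nnegrE ?(ltW D0) ?(ltW DC) ?mulr_ge0// ltW.
  rewrite (_ : (2 * C) ^+ 3 = 8 * C ^+ 3); last by ring.
  move=> H; have : G * tau <= G * (256 * y ^+ 4) by lra.
  by rewrite ler_pM2l//; lra.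
have Nr : 0 <= N r.
  apply: le_trans Na _; move: ar; rewrite le_eqVlt => /predU1P[->//|ar].
  by rewrite ltW// N_lt// ltW.
have sup := supporting_line r b (ltW rar) rb; rewrite -/D in sup.
have tau2 : tau / 2 <= kap / r * (b - r).
  apply: le_trans (wprim_lipschitz n r b (le_trans r0a ar) rb).
  by rewrite rE /tau; lra.
have br0 : 0 <= b - r by rewrite subr_ge0.
(* From [N b <= C b] and [C <= D / 2], the supporting line gives
   [D (b - r) <= C r + D (b - r) / 2]. *)
have h1 : D * (b - r) <= 2 * (C * r).
  have : 2 * C * (b - r) <= D * (b - r) by rewrite ler_wpM2r.
  lra.
have tD : tau * D <= 4 * kap * C.
  have : tau / 2 * D <= kap / r * (b - r) * D by rewrite ler_wpM2r// ltW.
  have : kap / r * (D * (b - r)) <= kap / r * (2 * (C * r)).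
    by rewrite ler_wpM2l// divr_ge0// ltW.
  rewrite (_ : kap / r * (2 * (C * r)) = 2 * (kap * C)); last by field; rewrite gt_eqF.
  lra.
(* Combining the cube of [tD] with [Dcube] eliminates [D] and leaves
   [tau ^+ 4 <= 2048 kap ^+ 3 y ^+ 4]. *)
have : (tau * D) ^+ 3 <= (4 * kap * C) ^+ 3.
  by rewrite ler_pXn2r ?nnegrE// ?mulr_ge0// ltW.
rewrite exprMn (_ : (4 * kap * C) ^+ 3 = 64 * kap ^+ 3 * C ^+ 3); last by ring.
have t3 : 0 < tau ^+ 3 by rewrite exprn_gt0.
have k3 : 0 < kap ^+ 3 by rewrite exprn_gt0.
have h2 : tau ^+ 3 * (G * tau / 32) <= tau ^+ 3 * D ^+ 3 by rewrite ler_wpM2l// ltW.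
have h3 : kap ^+ 3 * C ^+ 3 <= kap ^+ 3 * (G * y ^+ 4) by rewrite ler_wpM2l// ltW.
move=> h4.
have : G * tau ^+ 4 <= G * (2048 * kap ^+ 3 * y ^+ 4).
  rewrite (exprS tau 3).
  lra.
rewrite ler_pM2l// => h5.
have : tau ^+ 4 <= (8 * kap * y) ^+ 4.
  apply: le_trans h5 _.
  pose q := kap ^+ 3 * y ^+ 4; have q0 : 0 < q by rewrite mulr_gt0.
  have : q <= q * kap by rewrite ler_peMr// ltW.
  rewrite (_ : (8 * kap * y) ^+ 4 = 4096 * (q * kap)); last by rewrite /q; ring.
  by rewrite (_ : _ * y ^+ 4 = 2048 * q); [lra|rewrite /q; ring].
rewrite ler_pXn2r ?nnegrE ?(ltW tau0)//; last by rewrite -mulrA mulr_ge0// ltW.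
by lra.
Qed.

(** * The ratio [N r / r]: unbounded and eventually nondecreasing *)

Hypothesis N_gt0 : forall r, ra <= r -> 0 < N r.
Hypothesis Gd_compact : forall c C : R, 0 < c ->
  exists2 gam, 0 < gam & forall m, c <= m <= C -> Gd m gam.
Hypothesis w_diverges : forall B, exists n, B < \sum_(k < n) w k * rk k.

Lemma ratio_lower_bound : exists2 c, 0 < c & forall r, rk 0 <= r -> c <= N r / r.
Proof.
have r0 := rk_gt0 0; have N0 := N_gt0 _ (ltW rk0); have D0 := rder_gt0 _ rk0.
pose c := Num.min (N (rk 0) / rk 0) (rder (rk 0)).
exists c; first by rewrite lt_min divr_gt0.
move=> r r0r; rewrite ler_pdivlMr ?(lt_le_trans r0)//.
apply: le_trans (supporting_line _ _ (ltW rk0) r0r).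
have c1 : c * rk 0 <= N (rk 0) by rewrite -ler_pdivlMr// ge_min lexx.
have : c * (r - rk 0) <= rder (rk 0) * (r - rk 0).
  by rewrite ler_wpM2r ?subr_ge0// ge_min lexx orbT.
lra.
Qed.

(** A bounded ratio stays in a compact part of the positive axis, where one constant [gam] serves;
    infinite time drives the slope above [2 C], and the supporting line at [rk n] breaks the bound
    at [2 * rk n]. *)
Lemma ratio_unbounded C : 0 < C -> exists2 r, rk 0 <= r & C < N r / r.
Proof.
move=> C0; apply: contrapT => noC.
have mC r : rk 0 <= r -> N r / r <= C.
  by move=> r0r; rewrite leNgt; apply/negP => Cr; apply: noC; exists r.
have [c c0 mc] := ratio_lower_bound.
have [gam gam0 Hgam] := Gd_compact c C c0.
have kap10 : 0 < kap - 1 by rewrite subr_gt0.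
pose A := gam / 16 * (kap - 1).
have A0 : 0 < A by rewrite mulr_gt0// divr_gt0.
have [n Hn] := w_diverges ((2 * C) ^+ 3 / A).
have r0n : rk 0 <= rk n.
  by elim: (n) => // k IH; exact: le_trans IH (ltW (rk_lt k)).
have ran : ra < rk n by exact: lt_le_trans rk0 r0n.
have := rder_cube_gain_windows n _ _ gam (lexx _) r0n (ltW gam0).
rewrite wprim_total mulrA -/A => H.
have {}H : A * (\sum_(k < n) w k * rk k) <= rder (rk n) ^+ 3 - rder (rk 0) ^+ 3.
  by apply: H => r /andP[r0r _]; apply: Hgam; rewrite mc// mC.
have D0 := rder_gt0 _ rk0; have Dn := rder_gt0 _ ran.
have D03 : 0 < rder (rk 0) ^+ 3 by rewrite exprn_gt0.
have : (2 * C) ^+ 3 < rder (rk n) ^+ 3.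
  by move: Hn; rewrite ltr_pdivrMr// mulrC; lra.
rewrite ltr_pXn2r ?nnegrE ?mulr_ge0 ?(ltW Dn) ?(ltW C0)// => CD.
have rn0 := rk_gt0 n.
have := mC (2 * rk n) _; rewrite ler_pdivrMr ?mulr_gt0// => {}mC.
have {}mC : N (2 * rk n) <= C * (2 * rk n) by apply: mC; lra.
have le2 : rk n <= 2 * rk n by lra.
have sup := supporting_line _ _ (ltW ran) le2.
have Nn := N_gt0 _ (ltW ran).
have : 2 * C * rk n < rder (rk n) * rk n by rewrite ltr_pM2r.
lra.
Qed.

(** Where the ratio exceeds its value at [rk 0], the chord from [rk 0] is steeper than the ratio,
    and the right derivative is at least as steep. *)
Lemma ratio_ge1_increasing_start :
  exists r, [/\ rk 0 <= r, 1 <= N r / r & N r / r <= rder r].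
Proof.
have r0 := rk_gt0 0; have N0 := N_gt0 _ (ltW rk0).
pose C := Num.max 1 (N (rk 0) / rk 0).
have [|r r0r Cr] := ratio_unbounded C; first by rewrite lt_max ltr01.
move: (Cr); rewrite gt_max => /andP[m1 m0].
exists r; split=> //; first exact: ltW.
have {}r0r : rk 0 < r.
  rewrite lt_neqAle r0r andbT; apply/eqP => rE.
  by move: m0; rewrite rE ltxx.
have r_gt0 := lt_trans r0 r0r.
have mr : N r / r * r = N r by rewrite divfK// gt_eqF.
move: m0; rewrite ltr_pdivrMr// => m0.
have bl := le_backward_line _ _ (ltW rk0) (ltW r0r).
have rr0 : 0 < r - rk 0 by rewrite subr_gt0.
by rewrite -(ler_pM2r rr0); move: mr bl m0; set m := N r / r; lra.
Qed.

(** [N x <= rder x * x] says that the supporting line at [x] is nonpositive at 0; by convexity this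
    persists to the right, and it makes the ratio nondecreasing. *)
Lemma ratio_nondecreasing r x y : rk 0 <= r -> N r / r <= rder r ->
  r <= x -> x <= y -> N x / x <= N y / y.
Proof.
move=> r0r mD rx xy.
have rar : ra < r by exact: lt_le_trans rk0 r0r.
have rax := lt_le_trans rar rx.
have r_gt0 := lt_trans ra_gt0 rar; have x_gt0 := lt_le_trans r_gt0 rx.
have y_gt0 := lt_le_trans x_gt0 xy.
move: mD; rewrite ler_pdivrMr// => mD.
have xD : N x <= rder x * x.
  have := le_backward_line _ _ (ltW rar) rx.
  have : rder r * r <= rder x * r.
    by rewrite ler_wpM2r ?(ltW r_gt0)//; exact: rder_le (ltW rar) rx.
  lra.
have sup := supporting_line _ _ (ltW rax) xy.
rewrite ler_pdivlMr//; have mx : N x / x * x = N x by rewrite divfK// gt_eqF.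
have : N x / x <= rder x by rewrite ler_pdivrMr.
rewrite -(subr_ge0 x y) in xy.
move=> /(ler_wpM2r xy); move: mx sup; set m := N x / x; lra.
Qed.

(** * Summing the time spent over geometric levels of the ratio *)

Context (th : R) (th1 : 1 < th).
Hypothesis levels : forall c, 1 <= c -> exists (G y : nat -> R) (Y : R),
  (forall j, [/\ 0 < G j, 0 < y j,
     (forall m, c * th ^+ j <= m <= c * th ^+ j.+1 -> Gd m (G j)) &
     (c * th ^+ j.+1) ^+ 3 <= G j * y j ^+ 4]) /\
  (forall J, \sum_(j < J) y j <= Y).

(** Past the starting point the ratio climbs through the levels [c * th ^+ j] in order; [level_time]
    bounds the time in each, and the bounds are summable, against [w_diverges]. *)
Lemma no_global_growth : False.
Proof.
have [r [r0r m1 mD]] := ratio_ge1_increasing_start.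
pose m s := N s / s; pose c := m r.
have mono := ratio_nondecreasing _ _ _ r0r mD.
have [G [y [Y [Hj HY]]]] := levels c m1.
have kap0 : 0 < kap by exact: lt_trans kap1.
have rar : ra < r by exact: lt_le_trans rk0 r0r.
have th0 : 0 < th by exact: lt_trans th1.
pose L j := 256 * y j ^+ 4 + 8 * kap * y j.
have time n j b : r <= b -> m b < c * th ^+ j ->
    wprim n b - wprim n r <= \sum_(i < j) L i.
  elim: j b => [|j IH] b rb mb.
    by move: mb; rewrite expr0 mulr1 ltNge mono.
  rewrite leNgt; apply/negP => ex; rewrite big_ord_recr /= in ex.
  set S := \sum_(i < j) L i in IH ex.
  have [G0 y0 HG CG] := Hj j.
  have L0 : 0 < L j by rewrite addr_gt0// !mulr_gt0// exprn_gt0.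
  have S0 : 0 <= S.
    apply: sumr_ge0 => i _; have [_ yi _ _] := Hj i.
    by rewrite addr_ge0// !mulr_ge0// ?exprn_ge0// ltW.
  (* Measured from [r], [v] is midway between [S] and the total time less [L j]: at the point [a]
     reaching it, level [j] has been entered by [IH], yet more than [L j] remains. *)
  pose v := wprim n r + (S + (wprim n b - wprim n r - L j)) / 2.
  have [|a /andP[ra' ab] aE] := wprim_IVT n r b v rb.
    by rewrite /v; apply/andP; split; lra.
  have ma : c * th ^+ j <= m a.
    rewrite leNgt; apply/negP => ma; have := IH a ra' ma.
    by rewrite aE /v; lra.
  have : wprim n b - wprim n a <= L j.
    have b0 : 0 < b by exact: lt_le_trans ra_gt0 (le_trans (ltW rar) rb).
    apply: (level_time n a b (c * th ^+ j.+1) (G j)) => //.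
    - exact: le_trans r0r ra'.
    - by rewrite mulr_gt0 ?exprn_gt0// (lt_le_trans ltr01).
    - move=> s /andP[as_ sb]; apply: HG.
      rewrite (le_trans ma (mono _ _ ra' as_)) /=.
      exact: le_trans (mono _ _ (le_trans ra' as_) sb) (ltW mb).
    - by apply/ltW/N_gt0/(le_trans (ltW rar)).
    - by rewrite -ler_pdivrMr// ltW.
  by rewrite aE /v; lra.
have y_le j : y j <= Y.
  apply: le_trans (HY j.+1); rewrite big_ord_recr /= lerDr.
  by apply: sumr_ge0 => i _; have [_ /ltW] := Hj i.
have Y0 : 0 < Y by have [_ y0 _ _] := Hj 0%N; exact: lt_le_trans y0 (y_le 0%N).
(* [y j <= Y] turns [y j ^+ 4] into at most [Y ^+ 3 * y j], so summability of [y] bounds the sum of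
   [L]. *)
pose B := (256 * Y ^+ 3 + 8 * kap) * Y.
have sumL j : \sum_(i < j) L i <= B.
  apply: (@le_trans _ _ ((256 * Y ^+ 3 + 8 * kap) * \sum_(i < j) y i)).
    rewrite mulr_sumr; apply: ler_sum => i _; have [_ y0 _ _] := Hj i.
    rewrite /L [leRHS]mulrDl lerD2r exprSr mulrA ler_wpM2r ?(ltW y0)// ler_wpM2l//.
    by rewrite ler_pXn2r ?nnegrE ?(ltW y0) ?(ltW Y0).
  rewrite ler_wpM2l// addr_ge0// mulr_ge0// ?exprn_ge0 ?(ltW Y0)//.
  exact: ltW.
have kap10 : 0 < kap - 1 by rewrite subr_gt0.
pose Z := kap / rk 0 * (r - rk 0).
have [n Hn] := w_diverges ((B + Z) / (kap - 1)).
move: Hn; rewrite ltr_pdivrMr// mulrC -wprim_total => Hn.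
have r0n k : rk 0 <= rk k.
  by elim: k => // k IH; exact: le_trans IH (ltW (rk_lt k)).
pose b := Num.max r (rk n).
have rb : r <= b by rewrite le_max lexx.
have c0 : 0 < c by exact: lt_le_trans m1.
have [j Hmj] := expr_unbounded th (m b / c) th1.
rewrite ltr_pdivrMr// mulrC in Hmj.
have tb := le_trans (time n j b rb Hmj) (sumL j).
have lip := wprim_lipschitz n _ _ (lexx _) r0r.
have : wprim n (rk n) <= wprim n b.
  apply: ler_sum => k _; apply: ler_wpM2l => //.
  by rewrite /clamp le_min !ge_min !ge_max !le_max !lexx !orbT.
rewrite -/Z in lip; lra.
Qed.

End ConvexGrowth.

(** * Lebesgue integrals over half-open intervals *)

Section LebesgueIntervals.
Context {R : realType}.
Notation mu := (@completed_lebesgue_measure R).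

Lemma borel_LebR (A : set R) : measurable A -> measurable (A : set (LebR R)).
Proof. by move=> mA; apply: sub_caratheodory; exact: mA. Qed.

Lemma measurable_itv_LebR (i : interval R) : measurable ([set` i] : set (LebR R)).
Proof. by apply: borel_LebR; exact: measurable_itv. Qed.

Lemma completed_lebesgue_measure_oc (a b : R) : a <= b ->
  mu `]a, b]%classic = (b - a)%:E.
Proof.
move=> ab; transitivity (lebesgue_measure (`]a, b]%classic : set R)); first by [].
rewrite lebesgue_measure_itv /= lte_fin; case: ltP => // ba.
by rewrite (_ : b = a) ?subrr//; apply/le_anti/andP.
Qed.

Lemma measurable_id_LebR (D : set R) :
  measurable_fun (D : set (LebR R)) ((fun x => x) : LebR R -> R).
Proof.
move=> mD B mB; apply: measurableI => //.
by rewrite (_ : _ @^-1` B = B)//; exact: borel_LebR.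
Qed.

Lemma integral_oc_le (h : R -> R) (a b M : R) : a <= b ->
  measurable_fun (`]a, b]%classic : set (LebR R)) (h : LebR R -> R) ->
  (forall x, a < x <= b -> 0 <= h x <= M) ->
  (\int[mu]_(x in `]a, b]) (h x)%:E <= (M * (b - a))%:E)%E.
Proof.
move=> ab mh hM.
rewrite EFinM -(completed_lebesgue_measure_oc _ _ ab).
rewrite -(integral_cst mu (measurable_itv_LebR `]a, b])).
apply: ge0_le_integral.
- exact: measurable_itv_LebR.
- by move=> x /=; rewrite in_itv => /hM /andP[h0 _]; rewrite lee_fin.
- exact/measurable_EFinP.
- exact: measurable_cst.
- by move=> x /=; rewrite in_itv => /hM /andP[_ ?]; rewrite lee_fin.
Qed.

Lemma le_integral_oc (h : R -> R) (a b M : R) : a <= b -> 0 <= M ->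
  measurable_fun (`]a, b]%classic : set (LebR R)) (h : LebR R -> R) ->
  (forall x, a < x <= b -> M <= h x) ->
  ((M * (b - a))%:E <= \int[mu]_(x in `]a, b]) (h x)%:E)%E.
Proof.
move=> ab M0 mh hM.
rewrite EFinM -(completed_lebesgue_measure_oc _ _ ab).
rewrite -(integral_cst mu (measurable_itv_LebR `]a, b])).
apply: ge0_le_integral.
- exact: measurable_itv_LebR.
- by move=> x _; rewrite lee_fin.
- exact: measurable_cst.
- exact/measurable_EFinP.
- by move=> x /=; rewrite in_itv => /hM ?; rewrite lee_fin.
Qed.

Lemma integral_oc_split (h : R -> R) (a b c : R) : a <= b -> b <= c ->
  measurable_fun (`]a, c]%classic : set (LebR R)) (h : LebR R -> R) ->
  (forall x, a < x <= c -> 0 <= h x) ->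
  (\int[mu]_(x in `]a, c]) (h x)%:E =
   \int[mu]_(x in `]a, b]) (h x)%:E + \int[mu]_(x in `]b, c]) (h x)%:E)%E.
Proof.
move=> ab bc mh h0.
have E : `]a, b]%classic `|` `]b, c]%classic = `]a, c]%classic :> set R.
  apply/seteqP; split=> x /=; rewrite !in_itv /=.
    by case=> /andP[? ?]; apply/andP; split; lra.
  by case: (leP x b) => ? /andP[? ?]; [left|right]; apply/andP; split; lra.
rewrite -E; apply: ge0_integral_setU; rewrite ?E.
- exact: measurable_itv_LebR.
- exact: measurable_itv_LebR.
- exact/measurable_EFinP.
- by move=> x /=; rewrite in_itv => /h0; rewrite lee_fin.
- rewrite disj_set2E; apply/eqP/seteqP; split=> x //= [].
  by rewrite !in_itv /= => /andP[? ?] /andP[? ?]; lra.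
Qed.

End LebesgueIntervals.

(** * Weights with divergent sum, from the infinite integral of [q] *)

Section SelectWeights.
Context {R : realType} (rs kap : R) (q : R -> R) (rk : nat -> R).
Hypotheses (rs_gt0 : 0 < rs) (rs_lt : rs < rk 0) (kap1 : 1 < kap)
  (rkS : forall k, rk k.+1 = kap * rk k).
Hypotheses (q_ge0 : forall r, rs < r -> 0 <= q r)
  (mq : measurable_fun (`]rs, +oo[ : set (LebR R)) (q : LebR R -> R))
  (q_bd : forall b, exists M, forall r, rs < r <= b -> q r <= M).
Notation mu := (@completed_lebesgue_measure R).
Hypothesis q_int : (\int[mu]_(r in `]rs, +oo[) (q r)%:E = +oo)%E.

Let p k r := Num.min 1 (rk k * q r).

Lemma rk_gt_rs k : rs < rk k.
Proof.
elim: k => // k IH; rewrite rkS (lt_trans IH)// ltr_pMl//.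
exact: lt_trans rs_gt0 IH.
Qed.

Let rk_lt' k : rk k < rk k.+1.
Proof. by rewrite rkS ltr_pMl// (lt_trans rs_gt0 (rk_gt_rs k)). Qed.

Let p_ge0 k r : rs < r -> 0 <= p k r.
Proof.
move=> rsr; rewrite le_min ler01 mulr_ge0 ?q_ge0//.
by rewrite ltW// (lt_trans rs_gt0 (rk_gt_rs k)).
Qed.

(** The supremum of [p] over a window is finite thanks to the truncation at 1 but may not be
    attained, hence the factor 2. *)
Lemma near_max_in_window k : exists r, rk k <= r <= rk k.+1 /\
  forall s, rk k <= s <= rk k.+1 -> p k s <= 2 * p k r.
Proof.
have rsk s : rk k <= s -> rs < s by exact: lt_le_trans (rk_gt_rs k).
pose S := [set p k s | s in [set s | rk k <= s <= rk k.+1]].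
have wk : rk k <= rk k <= rk k.+1 by rewrite lexx ltW.
have ubS : ubound S 1 by move=> _ [s _ <-]; rewrite ge_min lexx.
have hS : has_sup S by split; [exists (p k (rk k)), (rk k)|exists 1].
case: (leP (sup S) 0) => S0.
  exists (rk k); split=> // s sk.
  apply: (@le_trans _ _ 0); last by rewrite mulr_ge0// p_ge0// rsk.
  by apply: le_trans S0; apply: ub_le_sup; [exists 1|exists s].
have S2 : 0 < sup S / 2 by rewrite divr_gt0.
have [_ [r rk_ <-] Hr] := sup_adherent S2 hS.
exists r; split=> // s sk.
have : p k s <= sup S by apply: ub_le_sup; [exists 1|exists s].
lra.
Qed.

(** If the sums were bounded, the terms would tend to 0, the truncation would be inactive from some
    window on, and the sums would control the integral of [q] there; before that window [q] is
    bounded. *)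
Lemma divergent_weights : exists rho : nat -> R,
  (forall k, rk k <= rho k <= rk k.+1) /\
  forall B, exists n, B < \sum_(k < n) Num.min 1 (rk k * q (rho k)).
Proof.
have [rho Hrho] := choice near_max_in_window.
exists rho; split=> [k|B0]; first by case: (Hrho k).
apply: contrapT => noB.
have HB n : \sum_(k < n) p k (rho k) <= B0.
  by rewrite leNgt; apply/negP => Bn; apply: noB; exists n.
have rsr k : rs < rho k.
  by have [/andP[h _] _] := Hrho k; exact: lt_le_trans (rk_gt_rs k) h.
(* The threshold [1 / 2] offsets the factor 2: [p k x < 1] on the whole window, so
   [p k x = rk k * q x]. *)
have [K HK] : exists K, forall k, (K <= k)%N -> p k (rho k) < 1 / 2.
  have cv : cvgn (series (fun k => p k (rho k))).
    apply: nondecreasing_is_cvgn.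
      by apply/nondecreasing_seqP => k; rewrite seriesSr lerDl p_ge0.
    by exists B0 => _ [k _ <-]; rewrite seriesEord; exact: HB.
  have /cvgrPdist_lt/(_ (1 / 2)) := cvg_series_cvg_0 cv.
  case=> [|K _ HK]; first lra.
  exists K => k Kk; have := HK k Kk; rewrite /= sub0r normrN.
  by rewrite ger0_norm// p_ge0.
have [Q HQ] := q_bd (rk K).
have Q0 : 0 <= Q.
  by apply: le_trans (q_ge0 _ (rk_gt_rs K)) (HQ _ _); rewrite rk_gt_rs lexx.
have msub a b : rs <= a -> measurable_fun (`]a, b]%classic : set (LebR R)) (q : LebR R -> R).
  move=> rsa; apply: measurable_funS mq; first exact: measurable_itv_LebR.
  by move=> x /=; rewrite !in_itv /= andbT => /andP[ax _]; exact: le_lt_trans ax.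
pose E n := Q * (rk K - rs) + 2 * (kap - 1) * \sum_(k < n) p k (rho k).
have bound i : (\int[mu]_(r in `]rs, (rk (K + i)%N)]) (q r)%:E <= (E (K + i)%N)%:E)%E.
  elim: i => [|i IH].
    rewrite addn0; apply: (@le_trans _ _ (Q * (rk K - rs))%:E).
      apply: integral_oc_le; [exact: ltW (rk_gt_rs K)|exact: msub|].
      by move=> x xK; rewrite HQ// q_ge0//; case/andP: xK.
    rewrite lee_fin lerDl mulr_ge0 ?sumr_ge0// => [|k _]; last exact: p_ge0.
    by rewrite mulr_ge0// subr_ge0 ltW.
  rewrite addnS; set k := (K + i)%N in IH *.
  have rk0 : 0 < rk k by exact: lt_trans rs_gt0 (rk_gt_rs k).
  rewrite (integral_oc_split _ _ (rk k))//; last 4 first.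
  - exact: ltW (rk_gt_rs k).
  - exact: ltW.
  - exact: msub.
  - by move=> x /andP[? _]; exact: q_ge0.
  have -> : E k.+1 = E k + 2 * p k (rho k) / rk k * (rk k.+1 - rk k).
    by rewrite /E big_ord_recr /= rkS; field; rewrite gt_eqF.
  rewrite EFinD leeD//; apply: integral_oc_le; [exact: ltW|exact: msub (ltW (rk_gt_rs k))|].
  move=> x /andP[kx xk]; rewrite q_ge0 ?(lt_trans (rk_gt_rs k))//=.
  rewrite ler_pdivlMr// mulrC.
  have [_ /(_ x)] := Hrho k; rewrite (ltW kx) xk => /(_ isT).
  have := HK k (leq_addr _ _).
  set pr := p k (rho k); clearbody pr.
  by rewrite /p; case: (leP 1 (rk k * q x)) => *; lra.
pose M := Q * (rk K - rs) + 2 * (kap - 1) * B0.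
have boundM i : (\int[mu]_(r in `]rs, (rk (K + i)%N)]) (q r)%:E <= M%:E)%E.
  apply: le_trans (bound i) _; rewrite lee_fin lerD2l ler_wpM2l//.
  by rewrite mulr_ge0// subr_ge0 ltW.
pose F i : set (LebR R) := `]rs, (rk (K + i)%N)]%classic.
have UF : \bigcup_i F i = (`]rs, +oo[%classic : set R).
  apply/seteqP; split=> x.
    by case=> i _; rewrite /F /= !in_itv /= andbT => /andP[].
  rewrite /= in_itv /= andbT => rsx.
  have [k Hk] := expr_unbounded kap (x / rk 0) kap1.
  have r00 : 0 < rk 0 by exact: lt_trans rs_lt.
  have rkE j : rk j = kap ^+ j * rk 0.
    by elim: j => [|j IH]; rewrite ?expr0 ?mul1r// rkS IH exprS mulrA.
  exists k => //; rewrite /F /= in_itv /= rsx /=.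
  rewrite rkE -ler_pdivrMr//; apply: le_trans (ltW Hk) _.
  by rewrite ler_weXn2l ?(ltW kap1)// leq_addl.
have : (\int[mu]_(r in \bigcup_i F i) (q r)%:E <= M%:E)%E.
  have cv : (\int[mu]_(r in F i) (q r)%:E)%E @[i --> \oo] --> (\int[mu]_(r in \bigcup_i F i) (q r)%:E)%E.
    apply: ge0_nondecreasing_set_cvg_integral.
    - apply/nondecreasing_seqP => i; apply/subsetPset => x.
      rewrite /F /= !in_itv /= addnS => /andP[-> /= xk].
      exact: le_trans xk (ltW (rk_lt' _)).
    - by move=> i; exact: measurable_itv_LebR.
    - by move=> i; apply/measurable_EFinP; exact: msub.
    - by move=> i x; rewrite /F /= in_itv /= => /andP[? _]; rewrite lee_fin q_ge0.
  rewrite -(cvg_lim _ cv)//; apply: lime_le; first by apply/cvg_ex; eexists; exact: cv.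
  by apply: nearW => i; exact: boundM.
by rewrite UF q_int.
Qed.

End SelectWeights.

(** * Levels with summable times, from the integrability condition on [g] *)

Section SelectLevels.
Context {R : realType} (g : R -> R).
Hypotheses (g_gt0 : forall t, 0 < t -> 0 < g t)
  (mg : measurable_fun (`](0:R)%R, +oo[ : set (LebR R)) (g : LebR R -> R)).
Notation mu := (@completed_lebesgue_measure R).
Let h t : R := (g t * t) `^ (- 4^-1).
Hypothesis h_int : (\int[mu]_(t in `[(1:R)%R, +oo[) (h t)%:E < +oo)%E.

Let measurable_h (D : set R) : measurable (D : set (LebR R)) ->
  D `<=` `](0:R)%R, +oo[ -> measurable_fun (D : set (LebR R)) (h : LebR R -> R).
Proof.
move=> mD D0; apply: (measurableT_comp (measurable_powR _)).
apply: measurable_funM; last exact: measurable_id_LebR.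
by apply: measurable_funS mg => //; exact: measurable_itv_LebR.
Qed.

Let h_ge0 t : 0 <= h t. Proof. exact: powR_ge0. Qed.

Lemma powR_inv4_expr4 (x : R) : 0 < x -> (x `^ (- 4^-1)) ^+ 4 = x^-1.
Proof.
move=> x0; rewrite -powR_mulrn ?powR_ge0// -powRrM mulNr mulVf ?pnatr_eq0//.
by rewrite powR_inv1// ltW.
Qed.

(** Choose [t j] in level [j] with [h (t j)] close to or below the mean of [h] there, and
    [y j = C j.+1 * h (t j)]; since [C j.+1] is proportional to the length of the level, the
    integral of [h] controls the sum. *)
Lemma summable_levels (th c : R) : 1 < th -> 1 <= c ->
  exists (t y : nat -> R) (Y : R),
  (forall j, [/\ c * th ^+ j <= t j <= c * th ^+ j.+1, 0 < y j &
     (c * th ^+ j.+1) ^+ 3 <= g (t j) * y j ^+ 4]) /\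
  (forall J, \sum_(j < J) y j <= Y).
Proof.
move=> th1 c1; pose C j := c * th ^+ j.
have c0 : 0 < c by exact: lt_le_trans c1.
have th0 : 0 < th by exact: lt_trans th1.
have th10 : 0 < th - 1 by rewrite subr_gt0.
have CS j : C j.+1 = th * C j by rewrite /C exprS; ring.
have C0 j : 0 < C j by rewrite mulr_gt0// exprn_gt0.
have CC j : C j < C j.+1 by rewrite CS ltr_pMl.
have C00 j : C 0%N <= C j.
  by elim: j => // j IH; exact: le_trans IH (ltW (CC j)).
have C01 : 1 <= C 0%N by rewrite /C expr0 mulr1.
have C1 j : 1 <= C j by exact: le_trans C01 (C00 j).
have mh a b : 0 < a -> measurable_fun (`]a, b]%classic : set (LebR R)) (h : LebR R -> R).
  move=> a0; apply: measurable_h; first exact: measurable_itv_LebR.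
  by move=> x /=; rewrite !in_itv /= andbT => /andP[ax _]; exact: lt_trans ax.
pose Itot := (\int[mu]_(t in `[(1:R)%R, +oo[) (h t)%:E)%E.
have part a b : 1 <= a -> (\int[mu]_(t in `]a, b]) (h t)%:E <= Itot)%E.
  move=> a1; apply: ge0_subset_integral.
  - exact: measurable_itv_LebR.
  - exact: measurable_itv_LebR.
  - apply/measurable_EFinP; apply: measurable_h; first exact: measurable_itv_LebR.
    by move=> x /=; rewrite !in_itv /= !andbT; exact: lt_le_trans.
  - by move=> x _; rewrite lee_fin.
  - move=> x /=; rewrite !in_itv /= andbT => /andP[ax _].
    exact: le_trans a1 (ltW ax).
have int_ge0 (D : set R) : (0 <= \int[mu]_(t in D) (h t)%:E)%E.
  by apply: integral_ge0 => x _; rewrite lee_fin.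
have tot_fin : Itot \is a fin_num by rewrite ge0_fin_numE ?int_ge0.
have part_fin a b : 1 <= a -> (\int[mu]_(t in `]a, b]) (h t)%:E)%E \is a fin_num.
  by move=> a1; rewrite ge0_fin_numE//; exact: le_lt_trans (part _ _ a1) h_int.
pose I j := fine (\int[mu]_(t in `](C j), (C j.+1)]) (h t)%:E)%E.
have IE j : (I j)%:E = (\int[mu]_(t in `](C j), (C j.+1)]) (h t)%:E)%E.
  by rewrite /I fineK// part_fin.
have I0 j : 0 <= I j by rewrite -lee_fin IE.
have sumI J : \sum_(j < J) I j <= fine Itot.
  rewrite -lee_fin fineK//; apply: le_trans (part (C 0%N) (C J) C01).
  elim: J => [|J IH]; first by rewrite big_ord0.
  rewrite (integral_oc_split _ _ _ _ (C00 J) (ltW (CC J)) (mh _ _ (C0 0%N)))//.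
  by rewrite big_ord_recr /= EFinD leeD// IE.
(* The summable slack [2^-1 ^+ j] gives the contradiction: if every [t] failed, the integral over
   the level would be at least [I j + 2^-1 ^+ j]. *)
have pick j : exists t, C j < t <= C j.+1 /\
    h t * (C j.+1 - C j) <= I j + 2^-1 ^+ j.
  apply: contrapT => no.
  have len : 0 < C j.+1 - C j by rewrite subr_gt0.
  have e0 : 0 < 2^-1 ^+ j :> R by rewrite exprn_gt0// invr_gt0.
  pose M := (I j + 2^-1 ^+ j) / (C j.+1 - C j).
  have : ((M * (C j.+1 - C j))%:E <= (I j)%:E)%E.
    rewrite IE; apply: le_integral_oc.
    - exact: ltW.
    - by rewrite /M; apply: divr_ge0; [apply: addr_ge0 => //|]; exact: ltW.
    - exact: mh.
    - move=> x xj; rewrite /M ler_pdivrMr// leNgt; apply/negP => hx.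
      by apply: no; exists x; split=> //; exact: ltW.
  by rewrite lee_fin /M divfK ?gt_eqF// gerDl leNgt e0.
have [t Ht] := choice pick.
have t0 j : 0 < t j.
  by have [/andP[h1 _] _] := Ht j; exact: lt_trans (C0 j) h1.
exists t, (fun j => C j.+1 * h (t j)), (th / (th - 1) * (fine Itot + 2)).
split=> [j|J].
  have [/andP[tj1 tj2] _] := Ht j.
  have gt0 : 0 < g (t j) * t j by rewrite mulr_gt0 ?g_gt0.
  split; first by rewrite (ltW tj1) tj2.
    by rewrite mulr_gt0// powR_gt0.
  rewrite -/(C j.+1) [(C j.+1 * _) ^+ 4]exprMn /h powR_inv4_expr4//.
  (* The fourth power of [h] cancels [g], and [t j <= C j.+1] makes the last factor at least 1. *)
  have -> : g (t j) * (C j.+1 ^+ 4 / (g (t j) * t j)) = C j.+1 ^+ 3 * (C j.+1 / t j).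
    by field; rewrite !gt_eqF ?g_gt0.
  rewrite ler_peMr// ?exprn_ge0 ?(ltW (C0 _))//.
  by rewrite ler_pdivlMr ?mul1r.
have geo : \sum_(j < J) 2^-1 ^+ j <= 2 :> R.
  have : \sum_(j < J) 2^-1 ^+ j = 2 - 2 * 2^-1 ^+ J :> R.
    elim: J => [|J IH]; first by rewrite big_ord0 expr0 mulr1 subrr.
    by rewrite big_ord_recr /= IH exprS; field.
  have : 0 < 2^-1 ^+ J :> R by rewrite exprn_gt0// invr_gt0.
  lra.
apply: (@le_trans _ _ (th / (th - 1) * \sum_(j < J) (I j + 2^-1 ^+ j))).
  rewrite mulr_sumr; apply: ler_sum => j _; have [_ hj] := Ht j.
  apply: le_trans (ler_wpM2l _ hj); last by rewrite divr_ge0// ltW.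
  rewrite CS le_eqVlt; apply/orP; left; apply/eqP; field.
  by rewrite gt_eqF.
rewrite ler_wpM2l// ?divr_ge0 ?(ltW th0) ?(ltW th10)//.
by rewrite big_split; exact: lerD (sumI J) geo.
Qed.

End SelectLevels.

(** * Application to [ballmax]: a positive value of [u] contradicts the growth estimates *)

Theorem theorem1 (R : realType) (n : nat) (Omega : set 'rV[R]_n) (rs : R)
  (f : 'rV[R]_n -> R -> R) (sigma theta : R) (q g : R -> R) :
  (2 <= n)%N ->
  open Omega -> connected Omega -> Omega !=set0 ->
  ~ (exists M : R, forall x, Omega x -> enorm x <= M) ->
  0 < rs ->
  (forall r, rs < r -> exists x, Omega x /\ enorm x = r) ->
  (forall x t, Omega x -> 0 < t -> 0 < f x t) ->
  1 < sigma -> 1 < theta ->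
  measurable_fun (`]rs, +oo[ : set (LebR R)) (q : LebR R -> R) -> (forall r, rs < r -> 0 <= q r) ->
  measurable_fun (`](0:R)%R, +oo[ : set (LebR R)) (g : LebR R -> R) -> (forall t, 0 < t -> 0 <= g t) ->
  (forall K : set R, compact K -> K `<=` `](0:R)%R, +oo[ ->
     (0 < ereal_inf [set (g t)%:E | t in K])%E) ->
  (forall t r, 0 < t -> rs < r ->
     (ereal_inf [set (f xz.1 (enorm xz.1 * xz.2)%R)%:E | xz in
                  [set x | Omega x /\ (r / sigma < enorm x < r * sigma)%R]
                  `*` `](t / theta)%R, (t * theta)%R[ ]
        >= (q r * g t)%:E)%E) ->
  (\int[@completed_lebesgue_measure R]_(t in `[(1:R)%R, +oo[) ((g t * t) `^ (- 4^-1))%R%:E < +oo)%E ->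
  (\int[@completed_lebesgue_measure R]_(r in `]rs, +oo[) (q r)%:E = +oo)%E ->
  forall u : 'rV[R]_n -> R, nonneg_solution Omega f u ->
  forall x, closure Omega x -> u x = 0.
Proof.
move=> _ _ _ _ _ rs0 sphere fpos sig1 th1 mq q0 mg g0 g_inf fqg g_int q_int u solu x clx.
have [u_ge0 _] := solu.
apply: contrapT => ux0; have ux : 0 < u x.
  by rewrite lt_neqAle u_ge0// andbT eq_sym; apply/eqP.
have gpos t : 0 < t -> 0 < g t.
  move=> t0; have := g_inf [set t] (@compact_set1 _ t).
  rewrite image_set1 ereal_inf1 lte_fin; apply.
  by move=> _ ->; rewrite /= in_itv /= t0.
have fq y rho t zeta : Omega y -> 0 < t -> rs < rho ->
    rho / sigma < enorm y < rho * sigma -> t / theta < zeta < t * theta ->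
    q rho * g t <= f y (enorm y * zeta).
  move=> Oy t0 rho0 yrho zt; rewrite -lee_fin; apply: le_trans (fqg t rho t0 rho0) _.
  by apply: ereal_inf_lbound; exists (y, zeta) => //; split=> //=; rewrite in_itv.
(* With ratios strictly between 1 and [sigma] or [theta], closed windows and levels fit into the
   open ranges of [fqg]. *)
pose kap := (1 + sigma) / 2; pose th := (1 + theta) / 2.
have kap1 : 1 < kap by rewrite /kap; lra.
have kaps : kap < sigma by rewrite /kap; lra.
have th1' : 1 < th by rewrite /th; lra.
have tht : th < theta by rewrite /th; lra.
have sig0 : 0 < sigma by lra.
have theta0 : 0 < theta by lra.
have near_window p r rho : 0 < p -> p <= r <= kap * p -> p <= rho <= kap * p ->
    rho / sigma < r < rho * sigma.
  move=> p0 /andP[pr rp] /andP[prho rhop].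
  have kp : kap * p < sigma * p by rewrite ltr_pM2r.
  have sr : sigma * p <= sigma * r by rewrite ler_pM2l.
  have srho : sigma * p <= sigma * rho by rewrite ler_pM2l.
  by rewrite ltr_pdivrMr//; apply/andP; split; lra.
(* Local boundedness of [q]: in each geometric window one point [y] of [Omega] on the outer sphere
   gives [q r * g 1 <= f y |y|], by taking [t = zeta = 1]. *)
have q_bd b : exists M, forall r, rs < r <= b -> q r <= M.
  have [k Hk] := expr_unbounded kap (b / rs) kap1.
  have [M HM] : exists M, forall r, rs < r <= rs * kap ^+ k -> q r <= M.
    elim: (k) => [|i [M HM]].
      by exists 0 => r; rewrite expr0 mulr1 => /andP[h1 h2]; lra.
    have pi1 : 1 <= kap ^+ i by rewrite exprn_ege1// ltW.
    have ppos : 0 < rs * kap ^+ i by rewrite mulr_gt0// (lt_le_trans ltr01).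
    have RE : rs * kap ^+ i.+1 = kap * (rs * kap ^+ i) by rewrite exprS; ring.
    have prs : rs <= rs * kap ^+ i by rewrite ler_peMr// ltW.
    have pR : rs * kap ^+ i < rs * kap ^+ i.+1 by rewrite RE ltr_pMl.
    have [y [Oy yE]] := sphere _ (le_lt_trans prs pR).
    exists (Num.max M (f y (enorm y * 1) / g 1)) => r /andP[rsr rR].
    rewrite le_max; case: (leP r (rs * kap ^+ i)) => ri.
      by rewrite HM// rsr.
    rewrite ler_pdivlMr ?gpos//; apply/orP; right; apply: fq => //.
      apply: (near_window (rs * kap ^+ i)) => //.
        by rewrite yE -RE lexx andbT ltW.
      by rewrite -RE rR andbT ltW.
    by rewrite ltr_pdivrMr// !mul1r th1.
  exists M => r /andP[rsr rb]; apply: HM; rewrite rsr (le_trans rb)//.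
  by rewrite mulrC -ler_pdivrMr// ltW.
pose ra := Num.max (enorm x) rs.
have xra : enorm x <= ra by rewrite le_max lexx.
have rsra : rs <= ra by rewrite le_max lexx orbT.
have ra0 : 0 < ra by exact: lt_le_trans rs0 rsra.
pose rk k := (ra + 1) * kap ^+ k.
have rk0 : ra < rk 0%N by rewrite /rk expr0 mulr1 ltrDl.
have rkS k : rk k.+1 = kap * rk k by rewrite /rk exprS; ring.
have rk_pos := rk_gt0 ra rk kap ra0 rk0 kap1 rkS.
have rs_lt := le_lt_trans rsra rk0.
have [rho [rho_in rho_div]] :=
  divergent_weights rs kap q rk rs0 rs_lt kap1 rkS q0 mq q_bd q_int.
(* In effect the minimum of [1 / rk k] and [q (rho k)]. *)
pose w k := Num.min 1 (rk k * q (rho k)) / rk k.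
have rs_rho k : rs < rho k.
  have /andP[h1 _] := rho_in k.
  exact: lt_le_trans (rk_gt_rs rs kap rk rs0 rs_lt kap1 rkS k) h1.
have wE k : w k * rk k = Num.min 1 (rk k * q (rho k)).
  by rewrite /w divfK// gt_eqF.
have wq k : w k <= q (rho k).
  by rewrite /w ler_pdivrMr// mulrC ge_min lexx orbT.
have w0 k : 0 <= w k.
  rewrite divr_ge0 ?(ltW (rk_pos k))// le_min ler01 /=.
  by rewrite mulr_ge0 ?(ltW (rk_pos k))// q0.
pose N := ballmax Omega u.
pose P r F := forall y, Omega y -> enorm y = r -> u y = N r -> F < f y (u y).
pose Gd m G := exists t, [/\ 0 < t, t / theta < m < t * theta & G <= g t].
have N_gt0 r : ra <= r -> 0 < N r by exact: (ballmax_gt0 _ _ _ fpos solu ra x).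
apply: (no_global_growth N P ra _ _ _ rk w kap ra0 rk0 kap1 rkS w0 _ Gd _ N_gt0 _ _ th th1').
- by move=> r s; exact: (ballmax_lt _ _ _ fpos solu ra x).
- move=> a b lam raa ab lam0 HP.
  apply: (ballmax_barrier _ _ _ fpos solu ra x) => // y Oy yab uy.
  exact: HP yab _ Oy erefl uy.
- by move=> r rar y Oy _ ->; apply: fpos => //; exact: N_gt0.
- by move=> k; rewrite wE ge_min lexx.
(* At a maximum point [u y = |y| * (N r / r)], so [fq] applies with [zeta = N r / r]; both [r] and
   [rho k] lie in window [k]. *)
- move=> k r G F rkr [t [t0 tm Gg]] G0 FG y Oy yE uy.
  apply: lt_le_trans FG _.
  have r0 : 0 < r by case/andP: rkr => h1 _; exact: lt_le_trans (rk_pos k) h1.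
  rewrite uy (_ : N r = enorm y * (N r / r)); last first.
    by rewrite yE mulrCA divff ?mulr1// gt_eqF.
  apply: (@le_trans _ _ (q (rho k) * g t)).
    by apply: ler_pM.
  apply: fq => //; rewrite yE; apply: (near_window (rk k)) => //.
    by rewrite -rkS.
  by rewrite -rkS.
(* On [[c, C]] the infimum of [g] serves, with [t = m]. *)
- move=> c C c0; case: (leP c C) => cC; last first.
    by exists 1 => // m /andP[cm mC]; have := le_trans cm mC; rewrite leNgt cC.
  have := g_inf _ (segment_compact (a := c) (b := C)).
  set e := ereal_inf _ => e_gt0.
  have {}e_gt0 : (0 < e)%E.
    apply: e_gt0 => y /=; rewrite !in_itv /= andbT => /andP[cy _].
    exact: lt_le_trans cy.
  have e_le m : c <= m <= C -> (e <= (g m)%:E)%E.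
    by move=> mcC; apply: ereal_inf_lbound; exists m => //=; rewrite in_itv.
  have ecC := e_le c; rewrite lexx cC in ecC; have {}ecC := ecC isT.
  have e_fin : e \is a fin_num.
    by rewrite ge0_fin_numE ?(ltW e_gt0)//; exact: le_lt_trans ecC (ltry _).
  exists (fine e); first by rewrite fine_gt0// e_gt0 (le_lt_trans ecC (ltry _)).
  move=> m mcC; exists m; have m0 : 0 < m by case/andP: mcC => h1 _; exact: lt_le_trans h1.
  split=> //; last by rewrite -lee_fin fineK// e_le.
  by rewrite ltr_pdivrMr// !ltr_pMr// th1.
- move=> B; have [J HJ] := rho_div B; exists J.
  by apply: lt_le_trans HJ _; apply: ler_sum => k _; rewrite wE.
(* [t j] and [m] share a level of ratio [th < theta], so each is within a factor [theta] of the
   other. *)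
move=> c c1; have [t [y [Y [Hj HY]]]] := summable_levels g gpos mg g_int th c th1' c1.
exists (fun j => g (t j)), y, Y; split=> // j.
have [/andP[tj1 tj2] y0 cy] := Hj j.
have cj0 : 0 < c * th ^+ j.
  by rewrite mulr_gt0 ?exprn_gt0//; [exact: lt_le_trans c1|exact: lt_trans th1'].
have t0 : 0 < t j by exact: lt_le_trans tj1.
split=> //; first exact: gpos.
have cE : c * th ^+ j.+1 = th * (c * th ^+ j) by rewrite exprS; ring.
rewrite cE in tj2 *; move=> m /andP[m1 m2]; exists (t j); split=> //.
have h1 : th * (c * th ^+ j) < theta * (c * th ^+ j) by rewrite ltr_pM2r.
have h2 : theta * (c * th ^+ j) <= theta * m by rewrite ler_pM2l.
have h3 : theta * (c * th ^+ j) <= theta * t j by rewrite ler_pM2l.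
by rewrite ltr_pdivrMr//; apply/andP; split; lra.
Qed.
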